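(* For $\sigma\in\mathfrak{S}_N$, let $L_\sigma=\mathrm{Diag}(P(\sigma))$ and $R_\sigma=\mathrm{Diag}(Q(\sigma))$ be the rank $N$ Okada half arc-diagrams of the saturated chains $P(\sigma)$ and $Q(\sigma)$ associated to $\sigma$ under Fomin's Robinson-Schensted correspondence for the Young-Fibonacci lattice. Then $A_\sigma=L_\sigma\bowtie R_\sigma$. Moreover $A_\sigma^\star=A_{\sigma^{-1}}=R_\sigma\bowtie L_\sigma$.
   Context: Okada arc-diagrams. Let $[N]=\{1,\dots,N\}$, $\overline{[N]}=\{\bar1,\dots,\bar N\}$, $|i|=|\bar i|=i$, ordered by $1<\dots<N<\bar N<\dots<\bar1$. A non-crossing arc-diagram of rank $N$ is a perfect matching of $[N]\cup\overline{[N]}$ (pairs are arcs) with no arcs $\{a,b\},\{c,d\}$ with $a<c<b<d$. Arc $\{a<b\}$ is nested in $\{c<d\}$ if $c<a<b<d$. An Okada arc-diagram is a non-crossing arc-diagram with integer labels on arcs such that the label of $\{a,b\}$ is at least $1$, at most $\min(|a|,|b|)$ and of the same parity as $\min(|a|,|b|)$, and an arc nested in another has a strictly larger label. Product $C\cdot D$: identify each node $\bar i$ of $C$ with node $i$ of $D$, concatenate arcs, discard closed loops, label each resulting arc by the minimum of the labels of the arcs composing it. The mirror $D^\star$ exchanges $i$ and $\bar i$ for all $i$ and keeps labels. $A_i$ ($1\le i<N$) is the Okada arc-diagram with arcs $\{a,\bar a\}$ labelled $a$ for $a\ne i,i+1$ and arcs $\{i,i+1\}$, $\{\bar i,\overline{i+1}\}$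 labelled $i$. For $\sigma\in\mathfrak{S}_N$ let $c_i=\#\{k<i:\sigma^{-1}(k)>\sigma^{-1}(i)\}$ and $A_\sigma=\prod_{i=1}^N(A_{i-1}A_{i-2}\cdots A_{i-c_i})$, factors ordered with $i$ increasing from left to right. Half diagrams. The left half of an Okada arc-diagram $D$ keeps the arcs joining two nodes of $[N]$ and replaces each arc joining $i\in[N]$ to $\overline{[N]}$ by a propagating half arc at $i$ with the same label; the right half of $D$ is the left half of $D^\star$. Okada half arc-diagrams are exactly the left halves of Okada arc-diagrams; $\mathrm{PropLab}(H)$ is the set of labels of the propagating half arcs of $H$. If $\mathrm{PropLab}(L)=\mathrm{PropLab}(R)$, then $L\bowtie R$ is the unique Okada arc-diagram with left half $L$ and right half $R$ (propagating half arcs with equal labels are joined). Young-Fibonacci lattice. A Fibonacci set of rank $n$ is a subset $S=\{s_1<\dots<s_k\}$ of $[n]$ with $k\equiv n\pmod2$ and $s_i\equiv i\pmod 2$ for all $i$ (the rank is part of the data). $S\lessdot T$ ($S$ of rank $n$, $T$ of rank $n+1$) whenever $T=S\setminus\{\max S\}$ or $S=T\setminus\{\max T\}$ as sets. $S^\sharp$ denotes the set $S$ regarded as having rank $n+2$. $\mathrm{Diag}(C_0\lessdot\dots\lessdot C_N)$, for a saturated chain with $C_0$ the empty set of rank $0$: start with the empty diagram; for $i=1,\dots,N$, if $C_i=C_{i-1}\cup\{\ell\}$ with $\ell\notin C_{i-1}$, add a propagating half arc at $i$ labelled $\ell$; if $C_i=C_{i-1}\setminus\{\ell\}$ with $\ell\in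 C_{i-1}$, replace the propagating half arc labelled $\ell$, at node $j$ say, by the full arc $\{j,i\}$ labelled $\ell$. Fomin's correspondence. On the grid $\{0,\dots,N\}^2$, the unit cell with upper right corner $(i,\sigma(i))$ contains a box for each $i$; other cells contain none. Assign to every vertex on the left or lower boundary the empty Fibonacci set of rank $0$. Inductively, for a unit cell with lower left corner assigned $S$ (of rank $n$), upper left corner $S'$, lower right corner $S''$, assign to the upper right corner $T$: if $S'\ne S$ and $S''\neq S$ then $T=S^\sharp$; if $S'=S''=S$ and the cell contains a box then $T=S\cup\{n+1\}$ (of rank $n+1$); otherwise $T=S''$ if $S'=S$, and $T=S'$ if $S''=S$. (Equality of Fibonacci sets includes equality of ranks.) Then $P(\sigma)$ is the chain read on the right border, from $(N,0)$ up to $(N,N)$, and $Q(\sigma)$ is the chain read on the top border, from $(0,N)$ to $(N,N)$; both are saturated chains from rank $0$ to rank $N$ with the same endpoint. *)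

(* Defs.v *)
From HB Require Import structures.
From mathcomp Require Import all_boot all_order all_fingroup.
From mathcomp Require Import finmap.

Set Implicit Arguments.
Unset Strict Implicit.
Unset Printing Implicit Defensive.

Local Open Scope fset_scope.

(* Nodes: for i : 'I_N, [inl i] is the node i+1 of [N] and [inr i] is the node
   with a bar over i+1.  [npos] embeds the order 1 < ... < N < bar N < ... < bar 1
   into nat. *)
Definition node (N : nat) : finType := ('I_N + 'I_N)%type.

Definition nabs N (x : node N) : nat :=
  match x with inl i => i.+1 | inr i => i.+1 end.

Definition npos N (x : node N) : nat :=
  match x with inl i => i.+1 | inr i => (N.*2 - i)%N end.

Definition nbar N (x : node N) : node N :=
  match x with inl i => inr i | inr i => inl i end.

Definition labelled (V : finType) : choiceType := ({set V} * nat)%type.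
Definition supp (V : finType) (p : labelled V) : {set V} := p.1.
Definition lab (V : finType) (p : labelled V) : nat := p.2.

(* A diagram is a set of labelled blocks of nodes.  Labels are in nat since the
   label of an arc in an Okada arc-diagram is at least 1. *)
Definition diagram (N : nat) := {fset labelled (node N)}.

Definition perfect_matching N (D : diagram N) : Prop :=
  (forall p, p \in D -> #|supp p| = 2) /\
  (forall x : node N, exists! p, p \in D /\ x \in supp p).

Definition noncrossing N (D : diagram N) : Prop :=
  forall (a b c d : node N) (l m : nat),
    ([set a; b]%SET, l) \in D -> ([set c; d]%SET, m) \in D ->
    ~ [/\ npos a < npos c, npos c < npos b & npos b < npos d].

Definition label_bounds N (D : diagram N) : Prop :=
  forall (a b : node N) (l : nat), ([set a; b]%SET, l) \in D ->
    1 <= l <= minn (nabs a) (nabs b) /\ odd l = odd (minn (nabs a) (nabs b)).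

Definition nested_increasing N (D : diagram N) : Prop :=
  forall (a b c d : node N) (l m : nat),
    ([set a; b]%SET, l) \in D -> ([set c; d]%SET, m) \in D ->
    [/\ npos c < npos a, npos a < npos b & npos b < npos d] -> m < l.

Definition okada N (D : diagram N) : Prop :=
  [/\ perfect_matching D, noncrossing D, label_bounds D & nested_increasing D].

Definition mirror N (D : diagram N) : diagram N :=
  [fset (@nbar N @: supp p, lab p) | p in D].

(* Product of C and D.  Glued nodes are (left nodes of C) + (common nodes)
   + (right nodes of D). *)
Definition gnode (N : nat) : finType := (('I_N + 'I_N) + 'I_N)%type.

Definition glue_fst N (x : node N) : gnode N :=
  match x with inl i => inl (inl i) | inr i => inl (inr i) end.

Definition glue_snd N (x : node N) : gnode N :=
  match x with inl i => inl (inr i) | inr i => inr i end.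

Definition glue_out N (x : node N) : gnode N :=
  match x with inl i => inl (inl i) | inr i => inr i end.

(* If C and D both have the same arc with the same label between two common
   nodes, the union identifies the two copies; they form a closed loop, which
   is discarded anyway. *)
Definition glued N (C D : diagram N) : {fset labelled (gnode N)} :=
  [fset (@glue_fst N @: supp p, lab p) | p in C] `|`
  [fset (@glue_snd N @: supp p, lab p) | p in D].

Definition glued_adj N (C D : diagram N) : rel (gnode N) :=
  fun x y => has (fun p => (x \in supp p) && (y \in supp p)) (glued C D).

(* The outer nodes of the connected component of the outer node x, that is, its
   two ends.  A closed loop has no outer node, so it never arises. *)
Definition prod_arc N (C D : diagram N) (x : node N) : {set node N} :=
  [set y : node N | connect (glued_adj C D) (glue_out x) (glue_out y)]%SET.

(* The default value N of the minimum is harmless: in an Okada arc-diagram all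
   labels are at most N. *)
Definition prod_label N (C D : diagram N) (x : node N) : nat :=
  \big[minn/N]_(p <- glued C D
               | [exists y in supp p, connect (glued_adj C D) (glue_out x) y]) lab p.

Definition diag_mul N (C D : diagram N) : diagram N :=
  [fset (prod_arc C D x, prod_label C D x) | x in [set: node N]%SET].

Definition diag_one (N : nat) : diagram N :=
  [fset ([set inl i; inr i]%SET : {set node N}, i.+1) | i in [set: 'I_N]%SET].

(* [gen N k] is A_k, with k in {1, ..., N-1}. *)
Definition gen (N k : nat) : diagram N :=
  [fset ([set inl i; inr i]%SET : {set node N}, i.+1)
     | i in [set i : 'I_N | (i.+1 != k) && (i.+1 != k.+1)]%SET] `|`
  [fset ([set inl u.1; inl u.2]%SET : {set node N}, k)
     | u in [set u : 'I_N * 'I_N | (u.1.+1 == k) && (u.2.+1 == k.+1)]%SET] `|`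
  [fset ([set inr u.1; inr u.2]%SET : {set node N}, k)
     | u in [set u : 'I_N * 'I_N | (u.1.+1 == k) && (u.2.+1 == k.+1)]%SET].

(* The c_i and the factors of A_sigma, shifted: i : 'I_N stands for i+1, so that
   the inner product below is A_i A_(i-1) ... A_(i+1-c). *)
Definition code N (s : 'S_N) (i : 'I_N) : nat :=
  #|[set k : 'I_N | (k < i) && ((s^-1)%g i < (s^-1)%g k)]%SET|.

Definition okada_perm N (s : 'S_N) : diagram N :=
  \big[@diag_mul N/diag_one N]_(i < N)
    \big[@diag_mul N/diag_one N]_(1 <= j < (code s i).+1) gen N (i.+1 - j).

(* Half diagrams: blocks of size 2 are arcs, blocks of size 1 are propagating
   half arcs. *)
Definition half_diagram (N : nat) := {fset labelled 'I_N}.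

Definition left_half N (D : diagram N) : half_diagram N :=
  [fset ([set i : 'I_N | inl i \in supp p]%SET, lab p)
     | p in D & [exists i : 'I_N, inl i \in supp p]].

Definition right_half N (D : diagram N) : half_diagram N :=
  left_half (mirror D).

Definition okada_half N (H : half_diagram N) : Prop :=
  exists2 D : diagram N, okada D & left_half D = H.

Definition prop_lab N (H : half_diagram N) : {fset nat} :=
  [fset lab p | p in H & #|supp p| == 1].

(* D is the diagram "L bowtie R": this is defined, and equal to D. *)
Definition is_bowtie N (L R : half_diagram N) (D : diagram N) : Prop :=
  [/\ okada_half L, okada_half R, prop_lab L = prop_lab R &
      unique (fun E : diagram N =>
                [/\ okada E, left_half E = L & right_half E = R]) D].

(* A Fibonacci set is a pair (rank, increasing sequence of its elements); the
   element s_(i+1) is [nth 0 s i]. *)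
Definition is_fib (n : nat) (s : seq nat) : bool :=
  [&& sorted ltn s, all (fun x => 0 < x <= n) s, odd (size s) == odd n
    & all (fun i => odd (nth 0 s i) == odd i.+1) (iota 0 (size s))].

Definition fib : eqType := {p : nat * seq nat | is_fib p.1 p.2}.

Definition rank (S : fib) : nat := (val S).1.
Definition elts (S : fib) : seq nat := (val S).2.

Lemma is_fib_sharp n s : is_fib n s -> is_fib n.+2 s.
Proof.
case/and4P=> ss bs ps es; apply/and4P; split=> //=; last by rewrite negbK.
by apply: sub_all bs => x /andP[-> /= /leq_trans->] //; apply: leqW.
Qed.

Lemma is_fib_add n s : is_fib n s -> is_fib n.+1 (rcons s n.+1).
Proof.
case/and4P=> ss bs /eqP ps es; apply/and4P; split.
- case: s ss bs {ps es} => [|x s] // ss bs; rewrite /= rcons_path [path _ _ _]ss.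
  by have /andP[] := allP bs _ (mem_last x s).
- rewrite all_rcons ltn0Sn leqnn /=.
  by apply: sub_all bs => x /andP[-> /= /leq_trans->] //.
- by rewrite size_rcons /= ps.
- apply/allP=> i; rewrite mem_iota add0n size_rcons /= ltnS leq_eqVlt nth_rcons.
  case/orP=> [/eqP-> | lti]; first by rewrite ltnn eqxx /= ps.
  by rewrite lti; apply: (allP es); rewrite mem_iota.
Qed.

Definition fib0 : fib := exist (fun p => is_fib p.1 p.2) (0, [::]) isT.

Definition fib_sharp (S : fib) : fib :=
  exist (fun p => is_fib p.1 p.2) ((rank S).+2, elts S)
    (is_fib_sharp (valP S)).

Definition fib_add (S : fib) : fib :=
  exist (fun p => is_fib p.1 p.2) ((rank S).+1, rcons (elts S) (rank S).+1)
    (is_fib_add (valP S)).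

(* t = s \ {max s}; as s is increasing, max s is its last item. *)
Definition del_max (s t : seq nat) : bool :=
  (s != [::]) && (t == take (size s).-1 s).

Definition fib_cover (S T : fib) : bool :=
  (rank T == (rank S).+1)
  && (del_max (elts S) (elts T) || del_max (elts T) (elts S)).

Definition is_chain (N : nat) (C : seq fib) : bool :=
  [&& size C == N.+1, nth fib0 C 0 == fib0 & sorted fib_cover C].

Definition chain (N : nat) := {C : seq fib | is_chain N C}.

(* Step i+1 of the construction of Diag.  Along a cover, exactly one of S and T
   contains the other, with a single element in the difference. *)
Definition Diag_step N (C : seq fib) (H : half_diagram N) (i : 'I_N) :
    half_diagram N :=
  let S := elts (nth fib0 C i) in
  let T := elts (nth fib0 C i.+1) in
  if all (mem T) S then
    H `|` [fset ([set i]%SET, l) | l in [seq l <- T | l \notin S]]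
  else
    [fset (if [&& #|supp p| == 1, lab p \in S & lab p \notin T]
           then (i |: supp p)%SET else supp p, lab p) | p in H].

Definition Diag N (C : chain N) : half_diagram N :=
  foldl (Diag_step (val C)) fset0 (enum 'I_N).

(* [local_rule b S S1 S2]: the upper right corner of a cell with lower left
   corner S, upper left corner S1, lower right corner S2; b tells whether the
   cell contains a box. *)
Definition local_rule (b : bool) (S S1 S2 : fib) : fib :=
  if (S1 != S) && (S2 != S) then fib_sharp S
  else if [&& S1 == S, S2 == S & b] then fib_add S
  else if S1 == S then S2 else S1.

(* The cell with lower left corner (i, j). *)
Definition has_box N (s : 'S_N) (i j : nat) : bool :=
  [exists k : 'I_N, (k == i :> nat) && (s k == j :> nat)].

Fixpoint growth N (s : 'S_N) (i : nat) : nat -> fib :=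
  match i with
  | 0 => fun=> fib0
  | i'.+1 => fix column (j : nat) : fib :=
      match j with
      | 0 => fib0
      | j'.+1 => local_rule (has_box s i' j')
                   (growth s i' j') (growth s i' j'.+1) (column j')
      end
  end.

Lemma growthSS N (s : 'S_N) i j :
  growth s i.+1 j.+1 =
  local_rule (has_box s i j)
    (growth s i j) (growth s i j.+1) (growth s i.+1 j).
Proof. by []. Qed.

Lemma growth_0 N (s : 'S_N) i : growth s i 0 = fib0.
Proof. by case: i. Qed.

Lemma fib_cover_neq S T : fib_cover S T -> T == S = false.
Proof.
case/andP=> /eqP rT _; apply/eqP=> eTS.
by move: rT; rewrite eTS => /eqP; rewrite (ltn_eqF (ltnSn _)).
Qed.

Lemma fib_cover_sharp S T : fib_cover S T -> fib_cover T (fib_sharp S).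
Proof. by case/andP=> /eqP rT dST; rewrite /fib_cover rT eqxx orbC. Qed.

Lemma fib_cover_add S : fib_cover S (fib_add S).
Proof.
rewrite /fib_cover /del_max eqxx; apply/orP; right.
have -> : elts (fib_add S) = rcons (elts S) (rank S).+1 by [].
by rewrite -size_eq0 size_rcons -cats1 take_size_cat ?eqxx.
Qed.

Definition edge (v : bool) (S T : fib) : Prop :=
  if v then fib_cover S T : Prop else T = S.

Lemma local_ruleP (b v h : bool) S S1 S2 :
    edge v S S1 -> edge h S S2 -> (b -> ~~ v && ~~ h) ->
  edge (v || b) S2 (local_rule b S S1 S2) /\
  edge (h || b) S1 (local_rule b S S1 S2).
Proof.
rewrite /local_rule; case: v h b => [] [] [] //=; rewrite /edge //=.
- by move=> c1 c2 // /(_ isT).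
- move=> c1 c2 _; rewrite (fib_cover_neq c1) (fib_cover_neq c2) /=.
  by split; apply: fib_cover_sharp.
- by move=> c1 c2 // /(_ isT).
- by move=> c1 -> _; rewrite (fib_cover_neq c1) eqxx.
- by move=> c1 c2 // /(_ isT).
- by move=> -> c2 _; rewrite (fib_cover_neq c2) eqxx.
- by move=> -> -> _; rewrite eqxx /=; split; apply: fib_cover_add.
- by move=> -> -> _; rewrite eqxx.
Qed.

Lemma has_boxE N (s : 'S_N) (i j : 'I_N) : has_box s i j = (s i == j).
Proof.
apply/existsP/eqP=> [[k /andP[/eqP/val_inj-> /eqP/val_inj]] //|<-].
by exists i; rewrite !eqxx.
Qed.

Lemma growth_edges N (s : 'S_N) (i : nat) : i <= N ->
  (forall j : 'I_N, edge ((s^-1)%g j < i) (growth s i j) (growth s i j.+1)) /\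
  (forall (k : 'I_N) (j : nat), i = k -> j <= N ->
     edge (s k < j) (growth s i j) (growth s i.+1 j)).
Proof.
have box0 (k j : 'I_N) : has_box s k j -> ~~ ((s^-1)%g j < k) && ~~ (s k < j).
  by rewrite has_boxE => /eqP <-; rewrite permK !ltnn.
have horiz (k : 'I_N) :
    (forall j : 'I_N, edge ((s^-1)%g j < k) (growth s k j) (growth s k j.+1)) ->
    forall j, j <= N -> edge (s k < j) (growth s k j) (growth s k.+1 j).
  move=> V; elim=> [|j IHj] ltj; first by rewrite !growth_0.
  have := local_ruleP (V (Ordinal ltj)) (IHj (ltnW ltj)) (@box0 k (Ordinal ltj)).
  case=> _; rewrite -growthSS; congr edge.
  by rewrite has_boxE ltnS [in RHS]leq_eqVlt orbC.
elim: i => [_|i IHi ltiN].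
  have V (j : 'I_N) : edge ((s^-1)%g j < 0) (growth s 0 j) (growth s 0 j.+1).
    by [].
  by split=> // k j k0; move: V; rewrite k0 => /horiz; apply.
have [V H] := IHi (ltnW ltiN).
have V' (j : 'I_N) :
    edge ((s^-1)%g j < i.+1) (growth s i.+1 j) (growth s i.+1 j.+1).
  have := local_ruleP (V j) (H (Ordinal ltiN) j erefl (ltnW (ltn_ord j)))
    (@box0 (Ordinal ltiN) j).
  case=> + _; rewrite -growthSS; congr edge.
  rewrite (has_boxE s (Ordinal ltiN)) ltnS [in RHS]leq_eqVlt orbC; congr orb.
  by rewrite -(inj_eq (@perm_inj _ s^-1)%g) permK eq_sym.
by split=> // k j ik; move: V'; rewrite ik => /horiz; apply.
Qed.

Lemma P_is_chain N (s : 'S_N) : is_chain N (mkseq (growth s N) N.+1).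
Proof.
apply/and3P; split; rewrite ?size_mkseq ?nth_mkseq ?growth_0 //.
apply/(sortedP fib0)=> j; rewrite size_mkseq ltnS => ltj.
have [V _] := growth_edges s (leqnn N).
by have:= V (Ordinal ltj); rewrite !nth_mkseq ?ltnS ?(ltnW ltj) // ltn_ord.
Qed.

Lemma Q_is_chain N (s : 'S_N) :
  is_chain N (mkseq (fun i => growth s i N) N.+1).
Proof.
apply/and3P; split; rewrite ?size_mkseq ?nth_mkseq //.
apply/(sortedP fib0)=> i; rewrite size_mkseq ltnS => lti.
have [_ H] := growth_edges s (ltnW lti).
have:= H (Ordinal lti) N erefl (leqnn N).
by rewrite !nth_mkseq ?ltnS ?(ltnW lti) // ltn_ord.
Qed.

Definition Pchain N (s : 'S_N) : chain N :=
  exist (is_chain N) (mkseq (growth s N) N.+1) (P_is_chain s).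

Definition Qchain N (s : 'S_N) : chain N :=
  exist (is_chain N) (mkseq (fun i => growth s i N) N.+1) (Q_is_chain s).

(* Main.v *)
Require Import Defs.
From mathcomp Require Import all_boot all_order all_fingroup.
From mathcomp Require Import finmap.
From mathcomp Require Import zify.

(** Both sides of the identity are built by adding the values 1, 2, ..., N one
    at a time, and on both sides adding a value is the same operation.

    Put the nodes on a line, 1 < ... < k < bar k < ... < bar 1.  The factor of
    the permutation diagram that belongs to the value k+1 is A_k ... A_m.
    Multiplying a diagram of rank k (completed by the strands {j, bar j}, j > k)
    by it on the right inserts a short arc, labelled m, between two neighbours
    of the line: the new arc is {bar m, bar (m+1)}, the nodes bar m, ..., bar
    (k-1) move two places further, and the arc that ended at bar k now ends at
    k+1 ([insert_arc], [insert_arc_step], [insert_arc_gens]).  If the factor is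
    empty, then m = k+1 and the new arc is {k+1, bar (k+1)}.  As the ends of the
    new arc are neighbours, it crosses nothing, and every arc around it has a
    label below m ([okada_insert_arc]).

    In the growth diagram, the local rules turn the chain C_0, ..., C_k of a row
    into the chain C_0, ..., C_(m-1), C_(m-1) + {m}, and then the sets
    C_(m-1), ..., C_(k-1) again, in rank two higher.  Compare this with the
    labels of the arcs that are still open after the first i nodes of the right
    side have been read: the insertion changes them in exactly the same way
    ([open_right_below], [open_right_at], [open_right_above]).  Hence the set at
    each vertex of the growth diagram is a set of open labels
    ([growth_labels]).  For the right border, read at the end of the row, these
    are the labels of the arcs that join the two sides; they can be read off the
    left side too ([open_left_right]), which later insertions only extend
    ([open_left_insert]).  Arcs that are open at the same time are nested, so
    their labels are distinct, and therefore the chain of sets of open labels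
    dictates which half arcs have to be closed: it rebuilds the half diagram
    ([Diag_of_open_labels]).

    The iterated product is bracketed to the right while insertion multiplies on
    the right, so associativity is needed ([diag_mulA]).  Call a set of nodes
    stable at level t if it is a union of blocks of label at least t.  The
    stable sets of a product are the relational composite of the stable sets of
    its factors ([stable_mul]), and a product is determined by its stable sets
    ([canonical_eq]); so associativity is inherited from the composition of
    relations.  The same principle computes the product with a generator
    ([mul_gen]) without following any path of arcs.

    For the mirror image, inverting the permutation transposes the growth
    diagram ([growthV]), hence exchanges the two chains, while the mirror
    exchanges the two halves; and a diagram is determined by its halves, since
    propagating arcs have distinct labels ([eq_halves_sub]). *)

Set Implicit Arguments.
Unset Strict Implicit.
Unset Printing Implicit Defensive.

Local Open Scope fset_scope.

(** * Stable sets and associativity of the product *)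

Section StableSets.

Variable V : finType.
Implicit Types (G : {fset labelled V}) (h : pred V).

(** Connectedness is used only through its dual: stable sets at level 0 are the
    unions of components, and the least label along a component is at least t
    exactly when the component is stable at level t. *)
Definition stable t G h : Prop :=
  forall p u, p \in G -> u \in supp p -> h u ->
    t <= lab p /\ forall v, v \in supp p -> h v.

Lemma stable_leq t t' G h : t' <= t -> stable t G h -> stable t' G h.
Proof.
move=> le_t st p u pG up hu; have [tp hp] := st p u pG up hu.
by split=> //; apply: leq_trans tp.
Qed.

Definition adj G : rel V :=
  fun x y => has (fun p => (x \in supp p) && (y \in supp p)) G.

Lemma adj_sym G : connect_sym (adj G).
Proof.
by apply: sym_connect_sym => x y; apply: eq_has => p; rewrite andbC.
Qed.

Lemma stable_connect t G h u v :
  stable t G h -> connect (adj G) u v -> h u -> h v.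
Proof.
move=> st /connectP[q]; elim: q u => [|w q IHq] u /= => [_ -> //|].
case/andP=> /hasP[p pG /andP[up wp]] qP vE hu.
by apply: IHq qP vE _; have [_] := st p u pG up hu; apply.
Qed.

Lemma connect_block G p u v :
  p \in G -> u \in supp p -> v \in supp p -> connect (adj G) u v.
Proof.
by move=> pG up vp; apply: connect1; apply/hasP; exists p; rewrite ?up.
Qed.

(** The smallest stable set through u, which witnesses the two facts above. *)
Lemma component_stable t G u :
    (forall p v, p \in G -> v \in supp p -> connect (adj G) u v -> t <= lab p) ->
  stable t G (connect (adj G) u).
Proof.
move=> Gt p v pG vp uv; split=> [|w wp]; first exact: Gt uv.
exact: connect_trans uv (connect_block pG vp wp).
Qed.

End StableSets.

Lemma leq_bigminP (I : eqType) (r : seq I) (P : pred I) (F : I -> nat) n t :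
  reflect (t <= n /\ forall i, i \in r -> P i -> t <= F i)
          (t <= \big[minn/n]_(i <- r | P i) F i).
Proof.
apply: (iffP idP) => [|[tn]].
- elim: r => [|i r IHr]; rewrite ?big_nil ?big_cons //.
  case: ifP => [Pi|nPi]; rewrite ?leq_min.
    case/andP=> ti /IHr[tn tr]; split=> // j; rewrite inE => /orP[/eqP->//|].
    exact: tr.
  case/IHr=> tn tr; split=> // j; rewrite inE => /orP[/eqP->|]; last exact: tr.
  by rewrite nPi.
- elim: r => [|i r IHr] tr; rewrite ?big_nil ?big_cons //.
  have {}IHr: t <= \big[minn/n]_(j <- r | P j) F j.
    by apply: IHr => j jr; apply: tr; rewrite inE jr orbT.
  by case: ifP => // Pi; rewrite leq_min IHr tr ?inE ?eqxx.
Qed.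

Section Product.

Variable N : nat.
Implicit Types (C D E : diagram N) (h : pred (node N)).

Definition side (a b : pred 'I_N) : pred (node N) :=
  fun x => match x with inl i => a i | inr i => b i end.

(** The relation between left and right parts of stable sets, composed through
    the common nodes [m]. *)
Definition compose_stable t C D h : Prop :=
  exists m : pred 'I_N,
    stable t C (side (h \o inl) m) /\ stable t D (side m (h \o inr)).

Lemma stable_image (V W : finType) (f : V -> W) t (G : {fset labelled V}) g :
  stable t [fset (f @: supp p, lab p) | p in G] g <-> stable t G (g \o f).
Proof.
split=> [st p u pG up gu | st _ _ /imfsetP[/= p pG ->] /imsetP[u up ->] gu].
  have pI : (f @: supp p, lab p) \in [fset (f @: supp p, lab p) | p in G].
    by apply/imfsetP; exists p.
  have [tp gp] := st _ (f u) pI (imset_f f up) gu; split=> // v vp.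
  exact/gp/imset_f.
have [tp gp] := st p u pG up gu; split=> //= _ /imsetP[v vp ->].
exact: gp.
Qed.

Lemma stable_fsetU (V : finType) t (G H : {fset labelled V}) g :
  stable t (G `|` H) g <-> stable t G g /\ stable t H g.
Proof.
split=> [st | [stG stH] p u]; last by rewrite inE => /orP[]; [apply: stG|apply: stH].
by split=> p u pG; apply: st; rewrite inE pG ?orbT.
Qed.

Lemma eq_stable (V : finType) t (G : {fset labelled V}) g g' :
  g =1 g' -> stable t G g -> stable t G g'.
Proof.
move=> eg st p u pG up; rewrite -eg => gu; have [tp gp] := st p u pG up gu.
by split=> // v vp; rewrite -eg gp.
Qed.

Lemma compose_stableP t C D h :
  compose_stable t C D h <->
  exists2 g : pred (gnode N), stable t (glued C D) g & g \o @glue_out N =1 h.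
Proof.
split=> [[m [stC stD]] | [g /stable_fsetU[/stable_image stC /stable_image stD] gh]].
  exists (fun v => match v with
                   | inl (inl i) => h (inl i)
                   | inl (inr i) => m i
                   | inr i => h (inr i) end); last by case.
  apply/stable_fsetU; split; apply/stable_image.
    by apply: eq_stable stC => -[].
  by apply: eq_stable stD => -[].
exists (fun i => g (inl (inr i))); split.
  by apply: eq_stable stC => -[i|i] //=; rewrite -gh.
by apply: eq_stable stD => -[i|i] //=; rewrite -gh.
Qed.

(** Two outer nodes are in the same component if and only if no stable set
    separates them: the component itself would be such a set. *)
Lemma mem_prod_arc C D x y :
  y \in prod_arc C D x <-> forall h, compose_stable 0 C D h -> h x -> h y.
Proof.
rewrite inE; split=> [xy h /compose_stableP[g st gh] | arc_xy].
  by rewrite -!gh; apply: stable_connect st xy.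
apply: (arc_xy (fun y => connect (glued_adj C D) (glue_out x) (glue_out y))).
  by apply/compose_stableP; exists (connect (glued_adj C D) (glue_out x)) => //;
    apply: component_stable.
exact: connect0.
Qed.

Lemma prod_arc_sym C D x y : (y \in prod_arc C D x) = (x \in prod_arc C D y).
Proof. by rewrite !inE (adj_sym (glued C D)). Qed.

Lemma leq_prod_label C D x t :
  t <= prod_label C D x <->
  t <= N /\ exists2 h, compose_stable t C D h & h x.
Proof.
split=> [/leq_bigminP[tN tG] | [tN [h /compose_stableP[g st gh] hx]]].
  split=> //.
  exists (connect (glued_adj C D) (glue_out x) \o @glue_out N); last exact: connect0.
  apply/compose_stableP; exists (connect (glued_adj C D) (glue_out x)) => //.
  apply: component_stable => p v pG vp xv; apply: tG => //.
  by apply/existsP; exists v; rewrite vp.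
apply/leq_bigminP; split=> // p pG /existsP[v /andP[vp xv]].
have [] // := st p v pG vp; apply: stable_connect st xv _.
by have := gh x => /= ->.
Qed.

(** The bound [t <= N] is there because the label of a product arc is a minimum
    that starts at N, so above N no product arc is stable. *)
Lemma stable_mul t C D h : t <= N ->
  stable t (diag_mul C D) h <-> compose_stable t C D h.
Proof.
move=> tN; split=> [st | st].
  have memD x : (prod_arc C D x, prod_label C D x) \in diag_mul C D.
    by apply/imfsetP; exists x => //=; rewrite inE.
  have arcx x : x \in prod_arc C D x by rewrite inE connect0.
  (* Extend h to the glued graph by the components of the outer nodes in h. *)
  apply/compose_stableP.
  exists (fun v => [exists x, h x && connect (glued_adj C D) (glue_out x) v]).
    move=> p u pG up /existsP[x /andP[hx xu]]; split=> [|v vp].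
      have [] := st _ x (memD x) (arcx x) hx => /leq_bigminP[_ /(_ p pG)] /= tp _.
      by apply: tp; apply/existsP; exists u; rewrite up.
    apply/existsP; exists x; rewrite hx; apply: connect_trans xu _.
    exact: (connect_block pG).
  move=> y; apply/existsP/idP => [[x /andP[hx xy]] | hy].
    have [_ hp] := st _ x (memD x) (arcx x) hx.
    by apply: hp; rewrite inE.
  by exists y; rewrite hy connect0.
move=> _ u /imfsetP[/= x _ ->] xu hu.
have st0 : compose_stable 0 C D h.
  by case: st => m [stC stD]; exists m; split; [move: stC|move: stD];
    apply: stable_leq.
split=> [|v xv].
  apply/leq_prod_label; split=> //; exists h => //.
  by move: xu; rewrite prod_arc_sym => /mem_prod_arc; apply.
move/mem_prod_arc: (xv); apply=> //.
by move: xu; rewrite prod_arc_sym => /mem_prod_arc; apply.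
Qed.

(** The diagrams that can be recovered from their stable sets: the arc of x is
    the smallest stable set through x, and its label is the highest level up to
    N at which it is stable. *)
Definition canonical D : Prop :=
  exists (arc : node N -> {set node N}) (l : node N -> nat),
  [/\ D = [fset (arc x, l x) | x in [set: node N]%SET],
      forall x y, y \in arc x <-> forall h, stable 0 D h -> h x -> h y
    & forall x t, t <= l x <-> t <= N /\ exists2 h, stable t D h & h x].

Lemma canonical_mul C D : canonical (diag_mul C D).
Proof.
exists (prod_arc C D), (prod_label C D); split=> // [x y | x t].
  by split=> [/mem_prod_arc xy h /stable_mul st | xy];
    [apply/xy/st | apply/mem_prod_arc => h st; apply/xy/stable_mul].
split=> [/leq_prod_label[tN [h st hx]] | [tN [h st hx]]].
  by split=> //; exists h => //; apply/stable_mul.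
by apply/leq_prod_label; split=> //; exists h => //; apply/stable_mul.
Qed.

Lemma canonical_eq D E : canonical D -> canonical E ->
  (forall t h, t <= N -> stable t D h <-> stable t E h) -> D = E.
Proof.
move=> [arcD [lD [DE arcDP lDP]]] [arcE [lE [EE arcEP lEP]]] DE_st.
have eq_arc x : arcD x = arcE x.
  by apply/setP=> y; apply/idP/idP => [/arcDP xy | /arcEP xy];
    [apply/arcEP|apply/arcDP] => h /DE_st st; apply/xy/st.
have eq_l x : lD x = lE x.
  by apply/eqP; rewrite eqn_leq; apply/andP; split;
    [apply/lEP; have/lDP[lN [h st hx]] := leqnn (lD x)
    |apply/lDP; have/lEP[lN [h st hx]] := leqnn (lE x)];
    split=> //; exists h => //; apply/DE_st.
by rewrite DE EE; apply: eq_imfset => //= x; rewrite eq_arc eq_l.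
Qed.

(** Both bracketings have the threefold relational composite as stable sets. *)
Theorem diag_mulA : associative (@diag_mul N).
Proof.
move=> C D E; apply: canonical_eq; try exact: canonical_mul.
move=> t h tN; split=> /(stable_mul _ _ _ tN) => [[m [stC]] | [m [+ stE]]].
  move/(stable_mul _ _ _ tN) => [m' [stD stE]]; apply/stable_mul => //.
  by exists m'; split=> //; apply/stable_mul => //; exists m.
move/(stable_mul _ _ _ tN) => [m' [stC stD]]; apply/stable_mul => //.
by exists m'; split=> //; apply/stable_mul => //; exists m.
Qed.

End Product.

(** * Okada matchings of all ranks at once *)

(** The point (false, a) stands for the node a+1 and (true, a) for its bar.
    Points are not bounded by N, so that a diagram of rank k is also, completed
    by the strands {j, bar j}, a diagram of every larger rank. *)
Notation point := (bool * nat)%type.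

Record matching := Matching { mate : point -> point; label : point -> nat }.

Definition before (x y : point) : bool :=
  match x.1, y.1 with
  | false, false => x.2 < y.2
  | false, true => true
  | true, false => false
  | true, true => y.2 < x.2
  end.

Definition flip (x : point) : point := (~~ x.1, x.2).

(** Okada arc-diagrams of rank k followed by strands.  That [mate_parity] holds
    reflects that an arc encloses an even number of points; it is part of the
    definition because the parity of labels cannot be propagated through
    insertions without it.  Arcs that involve strands satisfy the last two
    conditions automatically, hence the restriction to points below k. *)
Record okada_matching k st : Prop := {
  mateK : involutive (mate st);
  mate_neq : forall x, mate st x != x;
  label_mate : forall x, label st (mate st x) = label st x;
  mate_strand : forall x, k <= x.2 -> mate st x = flip x;
  label_strand : forall x, k <= x.2 -> label st x = x.2.+1;
  label_gt0 : forall x, 0 < label st x;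
  label_leq : forall x, label st x <= x.2.+1;
  label_odd : forall x,
    odd (label st x) = odd (minn x.2.+1 (mate st x).2.+1);
  mate_parity : forall x,
    odd (mate st x).2 (+) (mate st x).1 = ~~ (odd x.2 (+) x.1);
  noncrossing_low : forall x y, x.2 < k -> y.2 < k ->
    ~ [/\ before x y, before y (mate st x) & before (mate st x) (mate st y)];
  nested_low : forall x y, x.2 < k -> y.2 < k ->
    [/\ before x y, before y (mate st y) & before (mate st y) (mate st x)] ->
    label st x < label st y
}.

Section OkadaMatching.

Variables (k : nat) (st : matching) (ok : okada_matching k st).

Lemma mate_lt n x : k <= n -> x.2 < n -> (mate st x).2 < n.
Proof.
move=> kn xn; rewrite ltnNge; apply/negP=> nx.
have := mateK ok x; rewrite (mate_strand ok (leq_trans kn nx)) => Ex.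
by have := congr1 snd Ex => /=; lia.
Qed.

Lemma mate_ge x : k <= x.2 -> (mate st x).2 = x.2.
Proof. by move=> kx; rewrite (mate_strand ok). Qed.

Lemma matching_noncrossing x y :
  ~ [/\ before x y, before y (mate st x) & before (mate st x) (mate st y)].
Proof.
have [kx|xk] := leqP k x.2; last have [ky|yk] := leqP k y.2.
- rewrite (mate_strand ok kx); have [ky|yk] := leqP k y.2.
    rewrite (mate_strand ok ky).
    move: x y kx ky => [[] a] [[] b]; rewrite /before /= => ? ? []; lia.
  have := mate_lt (leqnn k) yk; case: (mate st y) => s c /=.
  by move: x y kx yk => [[] a] [[] b]; rewrite /before /=; case: s => ? ? ? []; lia.
- rewrite (mate_strand ok ky); have := mate_lt (leqnn k) xk.
  case: (mate st x) => s c /=.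
  by move: x y ky xk => [[] a] [[] b]; rewrite /before /=; case: s => ? ? ? []; lia.
- exact: (noncrossing_low ok).
Qed.

Lemma matching_nested x y :
  [/\ before x y, before y (mate st y) & before (mate st y) (mate st x)] ->
  label st x < label st y.
Proof.
have [ky|yk] := leqP k y.2; last have [kx|xk] := leqP k x.2.
- rewrite (mate_strand ok ky) (label_strand ok ky).
  have [kx|xk] := leqP k x.2.
    rewrite (mate_strand ok kx) (label_strand ok kx).
    by move: x y kx ky => [[] a] [[] b]; rewrite /before /= => ? ? []; lia.
  by move=> _; have := label_leq ok x; lia.
- rewrite (mate_strand ok kx); have := mate_lt (leqnn k) yk.
  case: (mate st y) => s c /=.
  by move: x y kx yk => [[] a] [[] b]; rewrite /before /=; case: s => ? ? ? []; lia.
- exact: (nested_low ok).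
Qed.

End OkadaMatching.

(** * Inserting a short arc *)

(** Indices start from 0, so [insert_arc k m] adds the arc {bar m+1, bar m+2}
    with label m+1 and produces rank k+1.  When m = k, the arc inserted in the
    middle of the line is {k+1, bar k+1}. *)
Definition new_right (m : nat) : point := (true, m).
Definition new_left (k m : nat) : point := if m < k then (true, m.+1) else (false, k).

(** The new places of the old points.  The strand at k is not an old point: it
    is not part of the diagram of rank k, and the insertion makes use of its two
    places.  This is why points x with [x.2 = k] are excluded below. *)
Definition shift k m (x : point) : point :=
  if x.1 && (m <= x.2 < k) then
    if x.2.+1 == k then (false, k) else (true, x.2.+2)
  else x.

Definition unshift k m (x : point) : point :=
  if x.1 then if m.+1 < x.2 <= k then (true, x.2 - 2) else x
  else if x.2 == k then (true, k.-1) else x.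

Definition insert_arc k m st : matching :=
  {| mate x := if x == new_right m then new_left k m
               else if x == new_left k m then new_right m
               else shift k m (mate st (unshift k m x));
     label x := if (x == new_right m) || (x == new_left k m) then m.+1
                else label st (unshift k m x) |}.

Ltac split_ifs :=
  repeat (match goal with |- context [if ?c then _ else _] =>
            lazymatch c with
            | context [if _ then _ else _] => fail
            | _ => case: (boolP c) => ?
            end
          end; rewrite /= ?xpair_eqE /=).

(** For explicit points, all statements on places and on the order of the line
    are comparisons of indices. *)
Ltac by_points :=
  rewrite /before /shift /unshift /new_right /new_left /= ?xpair_eqE /=;
  split_ifs; rewrite ?xpair_eqE /=; try lia.

Section InsertArc.

Variables (k m : nat) (mk : m <= k).

Lemma shiftK x : x.2 != k -> unshift k m (shift k m x) = x.
Proof. by move: x => [[] b] /= bk; apply/eqP; by_points. Qed.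

Lemma shift_new x : x.2 != k ->
  (shift k m x == new_right m = false) * (shift k m x == new_left k m = false).
Proof. by move: x => [[] b] /= bk; split; by_points. Qed.

Lemma new_leftE : (new_left k m == new_right m) = false.
Proof. by by_points. Qed.

Variant point_spec : point -> Prop :=
  | NewRight : point_spec (new_right m)
  | NewLeft : point_spec (new_left k m)
  | Shifted x of x.2 != k : point_spec (shift k m x).

Lemma unshiftK x : x != new_right m -> x != new_left k m ->
  (unshift k m x).2 != k /\ shift k m (unshift k m x) = x.
Proof.
move: x => [[] b]; rewrite /new_left /new_right; case: ltnP => mk';
  rewrite !xpair_eqE /= => ? ?; split; try apply/eqP; by_points.
Qed.

Lemma pointP x : point_spec x.
Proof.
have [->|nr] := eqVneq x (new_right m); first exact: NewRight.
have [->|nl] := eqVneq x (new_left k m); first exact: NewLeft.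
by have [uk <-] := unshiftK nr nl; apply: Shifted.
Qed.

Lemma before_shift x y : x.2 < k -> y.2 < k ->
  before (shift k m x) (shift k m y) = before x y.
Proof. by move: x y => [[] a] [[] b] /= ak bk; by_points. Qed.

Lemma shift_ltS x : x.2 != k -> ((shift k m x).2 < k.+1) = (x.2 < k).
Proof. by move: x => [[] b] /= bk; by_points. Qed.

Lemma shift_ge x : k <= x.2 -> shift k m x = x.
Proof. by move=> kx; rewrite /shift ifF //; lia. Qed.

Lemma leq_shift x : x.2 <= (shift k m x).2.
Proof. by move: x => [[] b] /=; by_points. Qed.

Lemma shift_parity x : x.2 != k ->
  odd (shift k m x).2 (+) (shift k m x).1 = odd x.2 (+) x.1.
Proof. by move: x => [[] b] /= bk; by_points. Qed.

(** The two ends of the new arc are neighbours: every old point compares with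
    both in the same way. *)
Lemma before_new_left x : x.2 < k ->
  before (new_left k m) (shift k m x) = before (new_right m) (shift k m x).
Proof. by move: x => [[] b] /= bk; by_points. Qed.

Lemma before_new_right x : x.2 < k ->
  before (shift k m x) (new_left k m) = before (shift k m x) (new_right m).
Proof. by move: x => [[] b] /= bk; by_points. Qed.

Lemma shift_after_new x : x.2 < k ->
  before (new_right m) (shift k m x) -> shift k m x = x /\ x.2 < m.
Proof.
by move: x => [[] b] /= bk; by_points; split=> //; lia.
Qed.

Variables (st : matching) (ok : okada_matching k st).
Let ins := insert_arc k m st.

Lemma mate_new_right : mate ins (new_right m) = new_left k m.
Proof. by rewrite /= eqxx. Qed.

Lemma before_new : before (new_left k m) (new_right m).
Proof. by by_points. Qed.

Lemma mate_new_left : mate ins (new_left k m) = new_right m.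
Proof. by rewrite /= new_leftE eqxx. Qed.

Lemma mate_shift x : x.2 != k -> mate ins (shift k m x) = shift k m (mate st x).
Proof. by move=> xk; rewrite /= !shift_new // shiftK. Qed.

Lemma label_new_right : label ins (new_right m) = m.+1.
Proof. by rewrite /= eqxx. Qed.

Lemma label_new_left : label ins (new_left k m) = m.+1.
Proof. by rewrite /= eqxx orbT. Qed.

Lemma label_shift x : x.2 != k -> label ins (shift k m x) = label st x.
Proof. by move=> xk; rewrite /= !shift_new // shiftK. Qed.

Lemma mate_neq_rank x : x.2 != k -> (mate st x).2 != k.
Proof.
move=> xk; have [kx|xk'] := leqP k x.2; first by rewrite (mate_ge ok).
by have := mate_lt ok (leqnn k) xk' => /ltn_eqF->.
Qed.

Lemma before_irr x : before x x = false.
Proof. by case: x => [[] a]; rewrite /before /= ltnn. Qed.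

Lemma before_trans y x z : before x y -> before y z -> before x z.
Proof. by move: x y z => [[] a] [[] b] [[] c]; rewrite /before /=; lia. Qed.

(** Nothing crosses the new arc or is nested in it, as its ends are neighbours.
    An arc around it ends at some bar b with b below m+1, and has label at most
    b.  On the old points below k, [shift] is increasing; by [mate_parity] the
    smaller end of an arc, whose parity the label has to match, keeps its
    parity. *)
Lemma okada_insert_arc : okada_matching k.+1 ins.
Proof.
split.
- move=> x; case: (pointP x) => [||{}x xk].
  + by rewrite mate_new_right mate_new_left.
  + by rewrite mate_new_left mate_new_right.
  + by rewrite !mate_shift ?mate_neq_rank // (mateK ok).
- move=> x; case: (pointP x) => [||{}x xk].
  + by rewrite mate_new_right new_leftE.
  + by rewrite mate_new_left eq_sym new_leftE.
  + rewrite mate_shift //; apply/eqP=> /(congr1 (unshift k m)).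
    by rewrite !shiftK ?mate_neq_rank // => /eqP; rewrite (negPf (mate_neq ok x)).
- move=> x; case: (pointP x) => [||{}x xk].
  + by rewrite mate_new_right label_new_left label_new_right.
  + by rewrite mate_new_left label_new_left label_new_right.
  + by rewrite mate_shift // !label_shift ?mate_neq_rank // (label_mate ok).
- move=> x; case: (pointP x) => [||{}x xk].
  + by rewrite /new_right /= => km; exfalso; lia.
  + by rewrite /new_left; case: (ltnP m k) => /= ? ?; exfalso; lia.
  + have [xk'|kx] := ltnP x.2 k; first by rewrite leqNgt ltnS -ltnS shift_ltS // xk'.
    by rewrite mate_shift // (mate_strand ok) // !shift_ge.
- move=> x; case: (pointP x) => [||{}x xk].
  + by rewrite /new_right /= => km; exfalso; lia.
  + by rewrite /new_left; case: (ltnP m k) => /= ? ?; exfalso; lia.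
  + have [xk'|kx] := ltnP x.2 k; first by rewrite leqNgt ltnS -ltnS shift_ltS // xk'.
    by rewrite label_shift // (label_strand ok) // !shift_ge.
- move=> x; case: (pointP x) => [||{}x xk].
  + by rewrite label_new_right.
  + by rewrite label_new_left.
  + by rewrite label_shift // (label_gt0 ok).
- move=> x; case: (pointP x) => [||{}x xk].
  + by rewrite label_new_right.
  + by rewrite label_new_left /new_left; case: (ltnP m k) => /=; lia.
  + by rewrite label_shift //; have := label_leq ok x; have := leq_shift x; lia.
- move=> x; case: (pointP x) => [||{}x xk].
  + by rewrite mate_new_right label_new_right /new_left; case: (ltnP m k) => /=; lia.
  + by rewrite mate_new_left label_new_left /new_left; case: (ltnP m k) => /=; lia.
  + rewrite label_shift // mate_shift // (label_odd ok).
    have := mate_neq_rank xk; have := mate_parity ok x.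
    have : (x.2 < k) = ((mate st x).2 < k).
      by apply/idP/idP => /(mate_lt ok (leqnn k)); rewrite ?(mateK ok).
    case: (mate st x) => s b; case: x xk => r a /=.
    rewrite /shift /= => ak ab par bk.
    by case: s par; case: r => /= par; split_ifs; lia.
- move=> x; case: (pointP x) => [||{}x xk].
  + by rewrite mate_new_right /new_right /new_left; case: (ltnP m k) => /=; lia.
  + by rewrite mate_new_left /new_right /new_left; case: (ltnP m k) => /=; lia.
  + by rewrite mate_shift // !shift_parity ?mate_neq_rank // (mate_parity ok).
- move=> x y; case: (pointP x) => [||{}x xk]; case: (pointP y) => [||{}y yk];
  rewrite ?mate_new_right ?mate_new_left ?mate_shift // ?shift_ltS //.
  + by rewrite before_irr => _ _ [].
  + by move=> _ _ [_]; rewrite before_irr.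
  + move=> _ yk'; rewrite (before_new_right yk') => -[/before_trans h /h].
    by rewrite before_irr.
  + by move=> _ _ [_]; rewrite before_irr.
  + by move=> _ _ []; rewrite before_irr.
  + move=> _ yk'; rewrite (before_new_left yk') => -[/before_trans h /h].
    by rewrite before_irr.
  + move=> xk' _; have xm := mate_lt ok (leqnn k) xk'.
    by rewrite (before_new_right xm) => -[_ /before_trans h /h]; rewrite before_irr.
  + move=> xk' _; have xm := mate_lt ok (leqnn k) xk'.
    by rewrite (before_new_left xm) => -[_ /before_trans h /h]; rewrite before_irr.
  + move=> xk' yk'; have := mate_lt ok (leqnn k) xk'; have := mate_lt ok (leqnn k) yk'.
    by move=> ? ?; rewrite !before_shift //; apply: (noncrossing_low ok).
- move=> x y; case: (pointP x) => [||{}x xk]; case: (pointP y) => [||{}y yk];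
  rewrite ?mate_new_right ?mate_new_left ?mate_shift // ?shift_ltS //.
  + by rewrite before_irr => _ _ [].
  + by move=> _ _ [/before_trans h /h]; rewrite before_irr.
  + move=> _ /(mate_lt ok (leqnn k)) yk'; rewrite (before_new_right yk').
    by move=> -[xy /(before_trans xy) h /(before_trans h)]; rewrite before_irr.
  + by move=> _ _ [xy]; move/(before_trans xy); rewrite before_irr.
  + by move=> _ _ []; rewrite before_irr.
  + move=> _ yk'; rewrite (before_new_left yk') => -[xy].
    by move/(before_trans xy)=> h /(before_trans h); rewrite before_irr.
  + by move=> _ _ [_ /(before_trans before_new)]; rewrite before_irr.
  + move=> xk' _ [_ _]; have xm := mate_lt ok (leqnn k) xk'.
    case/(shift_after_new xm) => _ mm; rewrite label_new_left label_shift //.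
    by rewrite -(label_mate ok); have := label_leq ok (mate st x); lia.
  + move=> xk' yk'; have := mate_lt ok (leqnn k) xk'; have := mate_lt ok (leqnn k) yk'.
    by move=> ? ?; rewrite !before_shift // !label_shift //; apply: (nested_low ok).
Qed.

End InsertArc.

(** * The diagram of a matching *)

Section DiagOf.

Variable N : nat.

Definition point_of (x : node N) : point :=
  match x with inl i => (false, val i) | inr i => (true, val i) end.

Definition arc_of st (x : node N) : {set node N} :=
  [set y | (point_of y == point_of x) || (point_of y == mate st (point_of x))]%SET.

Definition diag_of st : diagram N :=
  [fset (arc_of st x, label st (point_of x)) | x in [set: node N]%SET].

Lemma point_of_inj : injective point_of.
Proof. by move=> [i|i] [j|j] //= [/val_inj ->]. Qed.

Lemma point_of_lt x : (point_of x).2 < N.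
Proof. by case: x => i /=. Qed.

Lemma point_ofP (x : point) : x.2 < N -> exists y, point_of y = x.
Proof.
by move: x => [[] b] /= bN; [exists (inr (Ordinal bN))|exists (inl (Ordinal bN))].
Qed.

Lemma npos_before x y : (npos x < npos y) = before (point_of x) (point_of y).
Proof.
by case: x y => [[i iN]|[i iN]] [[j jN]|[j jN]]; rewrite /before /=; lia.
Qed.

Lemma nabs_point x : nabs x = (point_of x).2.+1.
Proof. by case: x. Qed.

Lemma nbar_point x : point_of (nbar x) = flip (point_of x).
Proof. by case: x. Qed.

Section Facts.

Variables (k : nat) (st : matching).
Hypotheses (kN : k <= N) (ok : okada_matching k st).

Lemma mate_point x : exists y, point_of y = mate st (point_of x).
Proof. exact/point_ofP/(mate_lt ok kN)/point_of_lt. Qed.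

Lemma arc_ofE x y : point_of y = mate st (point_of x) -> arc_of st x = [set x; y]%SET.
Proof.
by move=> Ey; apply/setP=> z; rewrite !inE -Ey !(inj_eq point_of_inj).
Qed.

Lemma arc_of_id x : x \in arc_of st x.
Proof. by rewrite inE eqxx. Qed.

Lemma card_arc_of x : #|arc_of st x| = 2.
Proof.
have [y Ey] := mate_point x; rewrite (arc_ofE Ey) cards2.
by rewrite -(inj_eq point_of_inj) Ey eq_sym (mate_neq ok).
Qed.

Lemma mem_arc_of x y : y \in arc_of st x ->
  arc_of st y = arc_of st x /\ label st (point_of y) = label st (point_of x).
Proof.
rewrite inE (inj_eq point_of_inj) => /orP[/eqP->|/eqP Ey] //.
rewrite Ey (label_mate ok); split=> //; apply/setP=> z.
by rewrite !inE Ey (mateK ok) orbC.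
Qed.

Lemma diag_ofP p : p \in diag_of st ->
  forall x, x \in supp p -> p = (arc_of st x, label st (point_of x)).
Proof. by case/imfsetP=> /= x _ -> y /= /mem_arc_of[-> ->]. Qed.

Lemma mem_diag_of x : (arc_of st x, label st (point_of x)) \in diag_of st.
Proof. by apply/imfsetP; exists x => //=; rewrite inE. Qed.

Lemma diag_of_arc a b l : ([set a; b]%SET, l) \in diag_of st ->
  point_of b = mate st (point_of a) /\ l = label st (point_of a).
Proof.
move=> abl; have := diag_ofP abl.
move=> /(_ a); rewrite /supp /= !inE eqxx => /(_ isT)[Eab El]; split=> //.
have := card_arc_of a; rewrite -Eab cards2; case: eqP => // ab _.
have : b \in arc_of st a by rewrite -Eab !inE eqxx orbT.
by rewrite inE (inj_eq point_of_inj) => /orP[/eqP ba|/eqP //]; case: ab.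
Qed.

Lemma okada_diag_of : okada (diag_of st).
Proof.
split.
- split=> [p /imfsetP[/= x _ ->]|x]; first exact: card_arc_of.
  exists (arc_of st x, label st (point_of x)); split; last first.
    by move=> q [qD xq]; rewrite (diag_ofP qD xq).
  by split; [apply: mem_diag_of|apply: arc_of_id].
- move=> a b c d l m /diag_of_arc[Eb _] /diag_of_arc[Ed _].
  by rewrite !npos_before Eb Ed; apply: matching_noncrossing ok _ _.
- move=> a b l /diag_of_arc[Eb ->].
  rewrite !nabs_point (label_gt0 ok) leq_min (label_leq ok) -(label_mate ok) -Eb.
  by rewrite (label_leq ok) Eb (label_mate ok) (label_odd ok).
- move=> a b c d l m /diag_of_arc[Eb ->] /diag_of_arc[Ed ->].
  by rewrite !npos_before Eb Ed; apply: matching_nested ok _ _.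
Qed.

Lemma stable_diag_of t h : stable t (diag_of st) h <->
  forall x, h x -> t <= label st (point_of x) /\
    forall y, point_of y = mate st (point_of x) -> h y.
Proof.
split=> [sth x hx | hP p x pD xp hx].
  have [tx hD] := sth _ x (mem_diag_of x) (arc_of_id x) hx; split=> // y Ey.
  by apply: hD => /=; rewrite (arc_ofE Ey) !inE eqxx orbT.
rewrite (diag_ofP pD xp); have [tx hm] := hP x hx; split=> //= y.
by rewrite inE (inj_eq point_of_inj) => /orP[/eqP->|/eqP/hm].
Qed.

(** An arc is itself a stable set, at any level up to its label, and labels are
    at most N. *)
Lemma canonical_diag_of : canonical (diag_of st).
Proof.
have stx t x : t <= label st (point_of x) ->
    stable t (diag_of st) (mem (arc_of st x)).
  move=> tx; apply/stable_diag_of => y /mem_arc_of[Ay Ly].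
  by rewrite Ly; split=> // z /arc_ofE Az; rewrite -Ay Az !inE eqxx orbT.
exists (arc_of st), (fun x => label st (point_of x)); split=> // [x y | x t].
  split=> [xy h st0 hx | H]; last by apply: (H _ (stx 0 x _)) => //; apply: arc_of_id.
  by have [_] := st0 _ x (mem_diag_of x) (arc_of_id x) hx; apply.
split=> [tx | [tN [h /stable_diag_of hP hx]]]; last by have [] := hP x hx.
split; last by exists (mem (arc_of st x)); [apply: stx|apply: arc_of_id].
by apply: leq_trans tx (leq_trans (label_leq ok _) (point_of_lt _)).
Qed.

End Facts.

Lemma eq_diag_of st st' : mate st =1 mate st' -> label st =1 label st' ->
  diag_of st = diag_of st'.
Proof.
move=> Em El; apply: eq_imfset => //= x; rewrite El; congr pair.
by apply/setP=> y; rewrite !inE Em.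
Qed.

Definition id_matching : matching :=
  {| mate := flip; label x := x.2.+1 |}.

Lemma okada_id_matching : okada_matching 0 id_matching.
Proof.
split=> //=.
- by case=> s a; rewrite /flip /= negbK.
- by case=> [[] a]; rewrite /flip xpair_eqE.
- by move=> x; rewrite minnn.
- by move=> x; rewrite addbN.
Qed.

Lemma diag_oneE : diag_one N = diag_of id_matching.
Proof.
have arcE i : arc_of id_matching (inl i) = [set inl i; inr i]%SET by exact: arc_ofE.
have arcE' i : arc_of id_matching (inr i) = [set inl i; inr i]%SET.
  by rewrite setUC; apply: arc_ofE.
apply/fsetP=> p; apply/imfsetP/imfsetP => /= [[i _ ->] | [[i|i] _ ->]].
- by exists (inl i); rewrite ?inE ?arcE.
- by exists i; rewrite ?inE ?arcE.
- by exists i; rewrite ?inE ?arcE'.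
Qed.

(** The strand {i, bar i} of the unit carries the label i, which is an upper
    bound for the label of any arc that ends at bar i. *)
Lemma mulD1 k st : k <= N -> okada_matching k st ->
  diag_mul (diag_of st) (diag_one N) = diag_of st.
Proof.
move=> kN ok; apply: canonical_eq; first exact: canonical_mul.
  exact: canonical_diag_of ok.
have ok0 := okada_id_matching.
move=> t h tN; split.
  move/(stable_mul _ _ _ tN) => [m []]; rewrite diag_oneE.
  move=> /(stable_diag_of ok) hC /(stable_diag_of ok0) h1.
  have mE i : m i = h (inr i).
    by apply/idP/idP=> mi; [have [_ ] := h1 (inl i) mi|have [_ ] := h1 (inr i) mi];
      [move/(_ (inr i))|move/(_ (inl i))]; apply.
  apply: eq_stable (_ : stable t _ (side (h \o inl) m)).
    by case=> i //=; rewrite mE.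
  exact/(stable_diag_of ok).
move=> /(stable_diag_of ok) hC; apply/stable_mul => //.
exists (h \o inr); split.
  by apply: eq_stable (_ : stable t _ h); [case|apply/(stable_diag_of ok)].
rewrite diag_oneE; apply/(stable_diag_of ok0) => x hx.
have hr : h (inr (match x with inl i => i | inr i => i end)) by case: x hx.
have [tl _] := hC _ hr; split=> [|y Ey].
  by apply: leq_trans tl (leq_trans (label_leq ok _) _) => /=; case: x hx hr.
by case: x y hr Ey {hx tl} => [i|i] [j|j] //= hr [/val_inj->].
Qed.

Lemma stable_pairs (V I : finType) t (f g : I -> V) (l : I -> nat) (A : {set I}) h :
  stable t [fset ([set f i; g i]%SET, l i) | i in A] h <->
  forall i, i \in A -> h (f i) = h (g i) /\ (h (f i) -> t <= l i).
Proof.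
split=> [sth i iA | hA _ u /imfsetP[/= i iA ->]].
  have memA : ([set f i; g i]%SET, l i) \in [fset ([set f i; g i]%SET, l i) | i in A].
    by apply/imfsetP; exists i.
  have /= Hf := sth _ (f i) memA; have /= Hg := sth _ (g i) memA.
  rewrite !inE !eqxx ?orbT in Hf Hg; split; last by case/(Hf isT).
  by apply/idP/idP=> [/(Hf isT)|/(Hg isT)] [_]; apply; rewrite !inE eqxx ?orbT.
have [fg tl] := hA i iA; rewrite /= !inE => hu.
have hfi : h u -> h (f i) by case/orP: hu => /eqP->; rewrite -?fg.
by move=> /hfi hf; split=> [|v]; [exact: tl|rewrite !inE => /orP[] /eqP->; rewrite -?fg].
Qed.

Lemma stable_gen t j h :
  stable t (gen N j.+1) h <->
  [/\ forall i : 'I_N, i != j :> nat -> i != j.+1 :> nat ->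
        h (inl i) = h (inr i) /\ (h (inl i) -> t <= i.+1),
      forall i i' : 'I_N, i = j :> nat -> i' = j.+1 :> nat ->
        h (inl i) = h (inl i') /\ (h (inl i) -> t <= j.+1)
    & forall i i' : 'I_N, i = j :> nat -> i' = j.+1 :> nat ->
        h (inr i) = h (inr i') /\ (h (inr i) -> t <= j.+1)].
Proof.
split.
  case/stable_fsetU=> /stable_fsetU[/stable_pairs H1 /stable_pairs H2] /stable_pairs H3.
  split=> [i ij ij'|i i' ij ij'|i i' ij ij'].
  - by apply: H1; rewrite inE !eqSS ij.
  - by apply: (H2 (i, i')); rewrite inE /= ij ij' !eqxx.
  - by apply: (H3 (i, i')); rewrite inE /= ij ij' !eqxx.
case=> H1 H2 H3; apply/stable_fsetU; split; [apply/stable_fsetU; split|];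
  apply/stable_pairs.
- by move=> i; rewrite inE !eqSS => /andP[]; apply: H1.
- by move=> [i i']; rewrite inE !eqSS => /andP[/eqP ij /eqP ij']; apply: H2.
- by move=> [i i']; rewrite inE !eqSS => /andP[/eqP ij /eqP ij']; apply: H3.
Qed.

(** Multiplying on the right by a generator joins the mates y and z of the two
    nodes bar j+1 and bar j+2 on which it acts, and creates an arc between the
    latter.  The joined arc takes the smaller of the two labels, which is the
    label of y here. *)
Lemma mul_gen k k' st st' j :
    k <= N -> okada_matching k st -> k' <= N -> okada_matching k' st' ->
    j.+1 < N ->
    let y := mate st (true, j) in let z := mate st (true, j.+1) in
    y != (true, j.+1) -> label st (true, j) <= label st (true, j.+1) ->
    mate st' (true, j) = (true, j.+1) -> label st' (true, j) = j.+1 ->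
    mate st' y = z -> label st' y = label st y ->
    (forall x, x \notin [:: (true, j); (true, j.+1); y; z] ->
       mate st' x = mate st x /\ label st' x = label st x) ->
  diag_mul (diag_of st) (gen N j.+1) = diag_of st'.
Proof.
move=> kN ok kN' ok' jN y z yj ljj mj lj my ly mx.
have j0N := ltnW jN; pose J : node N := inr (Ordinal j0N).
pose J1 : node N := inr (Ordinal jN).
have [Y EY] : exists Y : node N, point_of Y = y by apply: (mate_point kN ok J).
have [Z EZ] : exists Z : node N, point_of Z = z by apply: (mate_point kN ok J1).
have mY : mate st (point_of Y) = point_of J by rewrite EY (mateK ok).
have mZ : mate st (point_of Z) = point_of J1 by rewrite EZ (mateK ok).
have mY' : mate st' (point_of Y) = point_of Z by rewrite EY my EZ.
have mZ' : mate st' (point_of Z) = point_of Y by rewrite -mY' (mateK ok').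
have mJ : mate st (point_of J) = point_of Y by rewrite EY.
have mJ1 : mate st (point_of J1) = point_of Z by rewrite EZ.
have mJ' : mate st' (point_of J) = point_of J1 by rewrite /= mj.
have mJ1' : mate st' (point_of J1) = point_of J by rewrite -mJ' (mateK ok').
have lJ' : label st' (point_of J) = j.+1 by [].
have lJ1' : label st' (point_of J1) = j.+1 by rewrite -mJ' (label_mate ok').
have lY' : label st' (point_of Y) = label st (point_of Y) by rewrite EY.
have lZ' : label st' (point_of Z) = label st (point_of Y).
  by rewrite -mY' (label_mate ok').
have lJ : label st (point_of J) = label st (point_of Y) by rewrite -mJ (label_mate ok).
have lYj : label st (point_of Y) <= j.+1 by rewrite -lJ (label_leq ok).
have lYZ : label st (point_of Y) <= label st (point_of Z).
  by rewrite -lJ -mJ1 (label_mate ok).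
have YJ : Y != J.
  by apply: contraTneq (mate_neq ok (point_of J)) => YJ; rewrite mJ YJ eqxx.
have ZJ1 : Z != J1.
  by apply: contraTneq (mate_neq ok (point_of J1)) => ZJ; rewrite mJ1 ZJ eqxx.
have YJ1 : Y != J1 by rewrite -(inj_eq point_of_inj) EY.
have ZJ : Z != J.
  by apply: contra_neq YJ1 => ZJ; apply: point_of_inj; rewrite -mJ -ZJ mZ.
have other u : u \notin [:: J; J1; Y; Z] ->
    [/\ mate st' (point_of u) = mate st (point_of u),
        label st' (point_of u) = label st (point_of u)
      & forall v, point_of v = mate st (point_of u) -> v \notin [:: J; J1; Y; Z]].
  move=> uN; have [|-> ->] := mx (point_of u).
    by move: uN; rewrite !inE -!(inj_eq point_of_inj) EY EZ.
  split=> // v Ev; apply: contra uN.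
  have Eu : point_of u = mate st (point_of v) by rewrite Ev (mateK ok).
  rewrite !inE => /or4P[] /eqP Evv;
  move: Eu; rewrite Evv ?mJ ?mJ1 ?mY ?mZ => /point_of_inj->;
  by rewrite eqxx ?orbT.
have inj (u v : node N) : point_of v = point_of u -> v = u by move/point_of_inj.
apply: canonical_eq; [exact: canonical_mul|exact: canonical_diag_of ok'|].
have sub u : u \notin [:: J; J1; Y; Z] -> u \notin [:: J; J1].
  by rewrite !inE !negb_or => /and4P[-> ->].
have Jneq (i : 'I_N) : inr i \notin [:: J; J1] -> i != j :> nat /\ i != j.+1 :> nat.
  rewrite !inE negb_or => /andP[iJ iJ1]; split; [apply: contra iJ|apply: contra iJ1];
    by move=> /eqP ij; apply/eqP; congr inr; apply: val_inj.
move=> t h tN; split.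
  move/(stable_mul _ _ _ tN) => [m []] /(stable_diag_of ok).
  set g := side _ m => hC /stable_gen[H1 H2 H3].
  have gh u : u \notin [:: J; J1] -> g u = h u.
    by case: u => [i|i] // /Jneq[iJ iJ1]; have [] := H1 i iJ iJ1.
  have [gJ _] := H2 (Ordinal j0N) (Ordinal jN) erefl erefl.
  have {}gJ : g J = g J1 := gJ.
  have [hJ tJ] := H3 (Ordinal j0N) (Ordinal jN) erefl erefl.
  have {}hJ : h J = h J1 := hJ.
  have gY : g Y = h Y by apply: gh; rewrite !inE negb_or YJ.
  have gZ : g Z = h Z by apply: gh; rewrite !inE negb_or ZJ.
  have gnext u v : point_of v = mate st (point_of u) -> g u -> g v.
    by move=> uv gu; have [_] := hC u gu; apply.
  have hYZ : h Y = h Z.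
    rewrite -gY -gZ; apply/idP/idP=> [/(gnext _ J)|/(gnext _ J1)].
      by rewrite mY gJ => /(_ erefl) /(gnext _ Z); rewrite mJ1; apply.
    by rewrite mZ -gJ => /(_ erefl) /(gnext _ Y); rewrite mJ; apply.
  apply/(stable_diag_of ok') => u hu.
  have [uE|uO] := boolP (u \in [:: J; J1; Y; Z]); last first.
    have [-> -> uN] := other u uO; have gu : g u by rewrite gh ?sub.
    have [tu gv] := hC u gu; split=> // v uv.
    by rewrite -gh ?gv // sub // uN.
  move: uE hu; rewrite !inE => /or4P[] /eqP-> hu;
    rewrite ?mJ' ?mJ1' ?mY' ?mZ' ?lJ' ?lJ1' ?lY' ?lZ'.
  - by split=> [|v /inj->]; [exact: tJ|rewrite -hJ].
  - by rewrite -hJ in hu; split=> [|v /inj->]; [exact: tJ|].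
  - by rewrite -gY in hu; have [tY _] := hC Y hu; split=> // v /inj->; rewrite -hYZ -gY.
  - rewrite -hYZ in hu; split=> [|v /inj->] //.
    by rewrite -gY in hu; have [] := hC Y hu.
move=> /(stable_diag_of ok') hC.
have hnext u v : point_of v = mate st' (point_of u) -> h u -> h v.
  by move=> uv hu; have [_] := hC u hu; apply.
have hYZ : h Y = h Z by apply/idP/idP; apply: hnext; rewrite ?mY' ?mZ'.
have hJ : h J = h J1 by apply/idP/idP; apply: hnext; rewrite ?mJ' ?mJ1'.
(* On the two common nodes that the generator joins, a stable set takes the
   value that it has on the joined arc. *)
pose m i := if inr i \in [:: J; J1] then h Z else h (inr i).
pose g := side (h \o inl) m.
have gJ : g J = h Z by rewrite /g /= /m mem_head.
have gJ1 : g J1 = h Z by rewrite /g /= /m !inE eqxx orbT.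
have gh u : u \notin [:: J; J1] -> g u = h u.
  by case: u => [i|i] //; rewrite /g /= /m => /negPf->.
have gY : g Y = h Y by apply: gh; rewrite !inE negb_or YJ.
have gZ : g Z = h Z by apply: gh; rewrite !inE negb_or ZJ.
have tY : h Z -> t <= label st (point_of Y).
  by rewrite -hYZ => /hC[]; rewrite lY'.
apply/stable_mul => //; exists m; split.
  rewrite -/g; apply/(stable_diag_of ok) => u gu.
  have [uE|uO] := boolP (u \in [:: J; J1; Y; Z]); last first.
    have [<- lu uN] := other u uO; rewrite -lu; have hu : h u by rewrite -gh ?sub.
    have [tu hv] := hC u hu; split=> // v uv.
    by rewrite gh ?hv // sub // uN // uv; case: (other u uO).
  move: uE gu; rewrite !inE => /or4P[] /eqP-> gu; rewrite ?mJ ?mJ1 ?mY ?mZ.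
  - rewrite gJ in gu; rewrite lJ; split; [exact: tY|move=> v /inj->].
    by rewrite gY hYZ.
  - rewrite gJ1 in gu; rewrite -mZ (label_mate ok); split.
      by apply: leq_trans lYZ; exact: tY.
    by move=> v /inj->; rewrite gZ.
  - rewrite gY hYZ in gu; split; [exact: tY|move=> v /inj->].
    by rewrite gJ.
  - rewrite gZ in gu; split; first by apply: leq_trans lYZ; exact: tY.
    by move=> v /inj->; rewrite gJ1.
apply/stable_gen; split=> [i ij ij'|i i' ij ij'|i i' ij ij'] /=.
- have iN : inr i \notin [:: J; J1].
    by rewrite !inE -!(inj_eq point_of_inj) /= !xpair_eqE /= (negPf ij) (negPf ij').
  rewrite /m (negPf iN); split=> // /hC[ti _].
  exact: leq_trans ti (label_leq ok' _).
- have -> : i = Ordinal j0N by apply: val_inj.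
  have -> : i' = Ordinal jN by apply: val_inj.
  rewrite [m _]gJ [m (Ordinal jN)]gJ1; split=> // /tY tl.
  exact: leq_trans tl lYj.
- have -> : i = Ordinal j0N by apply: val_inj.
  have -> : i' = Ordinal jN by apply: val_inj.
  by split=> // /hC[+ _]; rewrite lJ'.
Qed.

End DiagOf.

(** * Permutation diagrams as iterated insertions *)
Lemma shiftS k m x : x != (true, m) -> shift k m.+1 x = shift k m x.
Proof.
move: x => [[] b]; rewrite xpair_eqE /= => bm; apply/eqP; by_points.
Qed.

(** A generator moves the short arc one step outwards: the node bar m+1 that it
    reaches gives its arc to the place which the short arc leaves. *)
Lemma insert_arc_step N k m st : m < k -> k < N -> okada_matching k st ->
  diag_mul (diag_of N (insert_arc k m.+1 st)) (gen N m.+1) =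
  diag_of N (insert_arc k m st).
Proof.
move=> mk kN ok; have mk' := ltnW mk.
have ok1 := okada_insert_arc mk ok; have ok0 := okada_insert_arc mk' ok.
have mnk : m != k by rewrite ltn_eqF.
have E1 : (true, m) = shift k m.+1 (true, m) by rewrite /shift /= ltnn.
pose w := mate st (true, m).
have wk : w.2 != k by apply: (mate_neq_rank ok).
have wm : w != (true, m) by apply: (mate_neq ok).
have Ey : mate (insert_arc k m.+1 st) (true, m) = shift k m.+1 w.
  by rewrite {1}E1 (mate_shift mk).
have Ez : mate (insert_arc k m.+1 st) (true, m.+1) = new_left k m.+1.
  exact: mate_new_right.
have Es : shift k m (true, m) = new_left k m.+1.
  rewrite /shift /new_left /= leqnn mk /=.
  by case: (ltngtP m.+1 k) => // km; exfalso; lia.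
apply: (mul_gen kN ok1 kN ok0); rewrite ?Ey ?Ez.
- by lia.
- by rewrite (shift_new mk wk).
- rewrite [X in X <= _](_ : _ = label st (true, m)); last first.
    by rewrite {1}E1 (label_shift mk).
  by rewrite (label_new_right k m.+1); have := label_leq ok (true, m) => /=; lia.
- by rewrite mate_new_right /new_left mk.
- exact: label_new_right.
- by rewrite shiftS // (mate_shift mk') // (mateK ok).
- by rewrite (label_shift mk) // shiftS // (label_shift mk').
move=> x; case: (pointP mk x) => [||{}x xk].
- by rewrite !inE eqxx !orbT.
- by rewrite !inE eqxx !orbT.
rewrite !inE !negb_or => /and4P[xm _ xy _].
have {}xm : x != (true, m) by apply: contraNneq xm => ->; rewrite -E1.
have xw : x != w by apply: contraNneq xy => ->.
rewrite (mate_shift mk) // (label_shift mk) // !shiftS //; last first.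
  by apply: contra xw => /eqP E; rewrite /w -E (mateK ok).
by rewrite (mate_shift mk') // (label_shift mk').
Qed.

(** Inserting in the middle of the line merely counts the first strand as part
    of the diagram. *)
Lemma insert_arc_last N k st : okada_matching k st ->
  diag_of N (insert_arc k k st) = diag_of N st.
Proof.
move=> ok; have kk := leqnn k.
have sh x : shift k k x = x by rewrite /shift ifF //; lia.
have lE : new_left k k = (false, k) by rewrite /new_left ltnn.
apply: eq_diag_of => x; case: (pointP kk x) => [||{}x xk].
- by rewrite mate_new_right (mate_strand ok).
- by rewrite (mate_new_left kk) lE (mate_strand ok).
- by rewrite mate_shift // !sh.
- by rewrite label_new_right (label_strand ok).
- by rewrite (label_new_left k k) lE (label_strand ok).
- by rewrite label_shift // !sh.
Qed.

(** The short arc is created in the middle of the line and then travels by c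
    steps. *)
Lemma insert_arc_gens N k c st : c <= k -> k < N -> okada_matching k st ->
  diag_mul (diag_of N st)
    (\big[@diag_mul N/diag_one N]_(1 <= j < c.+1) gen N (k.+1 - j)) =
  diag_of N (insert_arc k (k - c) st).
Proof.
move=> ck kN ok; rewrite -{1}(insert_arc_last N ok).
suff H j : j <= c -> diag_mul (diag_of N (insert_arc k (k - j) st))
    (\big[@diag_mul N/diag_one N]_(j.+1 <= i < c.+1) gen N (k.+1 - i)) =
    diag_of N (insert_arc k (k - c) st).
  by have := H 0 (leq0n c); rewrite subn0.
move=> jc; have [n Ec] : exists n, c = (j + n)%N by exists (c - j); lia.
elim: n j jc Ec => [|n IHn] j jc Ec.
  rewrite big_geq; last by lia.
  rewrite Ec addn0; apply: mulD1 kN _; apply: okada_insert_arc => //; lia.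
rewrite big_ltn; last by lia.
rewrite diag_mulA subSS; have -> : k - j = (k - j.+1).+1 by lia.
by rewrite insert_arc_step //; [apply: IHn|]; lia.
Qed.

Fixpoint insertions (pos : nat -> nat) k : matching :=
  if k is k'.+1 then insert_arc k' (pos k') (insertions pos k') else id_matching.

Lemma okada_insertions pos k : (forall j, j < k -> pos j <= j) ->
  okada_matching k (insertions pos k).
Proof.
elim: k => [|k IHk] posP; first exact: okada_id_matching.
apply: okada_insert_arc; first exact: posP.
by apply: IHk => j jk; apply/posP/ltnW.
Qed.

(** By associativity the blocks can be multiplied from left to right, starting
    with the identity. *)
Lemma insertionsE N (c pos : nat -> nat) :
    (forall k, k < N -> c k <= k /\ pos k = k - c k) ->
  \big[@diag_mul N/diag_one N]_(0 <= k < N)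
    \big[@diag_mul N/diag_one N]_(1 <= j < (c k).+1) gen N (k.+1 - j) =
  diag_of N (insertions pos N).
Proof.
move=> cP.
pose F k := \big[@diag_mul N/diag_one N]_(1 <= j < (c k).+1) gen N (k.+1 - j).
have ok k : k <= N -> okada_matching k (insertions pos k).
  by move=> kN; apply: okada_insertions => j jk; case: (cP j) => [|_ ->]; lia.
have step k : k < N -> diag_mul (diag_of N (insertions pos k)) (F k) =
    diag_of N (insertions pos k.+1).
  move=> kN; have [ck pE] := cP k kN.
  by rewrite (insert_arc_gens ck kN (ok _ (ltnW kN))) -pE.
suff H k : k <= N -> diag_mul (diag_of N (insertions pos k))
    (\big[@diag_mul N/diag_one N]_(k <= j < N) F j) = diag_of N (insertions pos N).
  have [N0|Ngt0] := posnP N.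
    by rewrite big_geq ?N0 // diag_oneE; move: N0; case: (N) => //.
  (* The first block is empty, hence absorbs the identity put in front. *)
  have F0 : F 0 = diag_one N.
    by rewrite /F big_geq //; have [] := cP 0 Ngt0; rewrite leqn0 => /eqP->.
  have := H 0 isT; rewrite big_ltn // F0.
  rewrite diag_mulA (mulD1 (leq0n N) okada_id_matching) => <-.
  by rewrite diag_oneE.
move=> kN; have [n EN] : exists n, N = (k + n)%N by exists (N - k); lia.
elim: n k kN EN => [|n IHn] k kN EN.
  have kE : k = N by lia.
  by rewrite big_geq ?kE //; apply: (mulD1 (leqnn N)); apply: ok.
rewrite big_ltn; last by lia.
by rewrite diag_mulA step; [apply: IHn|]; lia.
Qed.


(** * Open labels *)

(** Reading the first t nodes of the side b, an arc is open if just one of its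
    ends has been read. *)
Definition is_open st (b : bool) t a : bool :=
  (a < t) && ~~ (((mate st (b, a)).1 == b) && ((mate st (b, a)).2 < t)).

Definition open_label st b t l : Prop :=
  exists2 a, is_open st b t a & label st (b, a) = l.

Section OpenInsert.

Variables (k m : nat) (mk : m <= k) (st : matching) (ok : okada_matching k st).
Let ins := insert_arc k m st.

(** Openness is preserved when an old point moves, as long as the bounds t and
    t' cut the old points in the same way before and after the move. *)
Lemma open_shift b t t' a a' : a != k ->
    shift k m (b, a) = (b, a') -> (a' < t') = (a < t) ->
    (forall x, x.2 != k -> ((shift k m x).1 == b) && ((shift k m x).2 < t') =
                           (x.1 == b) && (x.2 < t)) ->
  (is_open ins b t' a' = is_open st b t a) *
  (label ins (b, a') = label st (b, a)).
Proof.
move=> ak Ea ltE insideE; have ak' : (b, a).2 != k by [].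
rewrite /is_open -Ea (mate_shift mk) // (label_shift mk) // ltE insideE //.
exact: (mate_neq_rank ok ak').
Qed.

Lemma open_left_insert t l : t <= k ->
  open_label ins false t l <-> open_label st false t l.
Proof.
move=> tk.
have E a : a < t -> (is_open ins false t a = is_open st false t a) *
    (label ins (false, a) = label st (false, a)).
  by move=> at_; apply: open_shift => // [|[[] c] /= ck]; [lia|by_points..].
split=> -[a oa al]; have at_ : a < t by case/andP: oa.
  by exists a; rewrite -?(E a).
by exists a; rewrite ?(E a).
Qed.

Lemma open_right_below t l : t <= m ->
  open_label ins true t l <-> open_label st true t l.
Proof.
move=> tm.
have E a : a < t -> (is_open ins true t a = is_open st true t a) *
    (label ins (true, a) = label st (true, a)).
  move=> at_; apply: open_shift => // [||[[] c] /= ck]; last by by_points.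
  - by lia.
  - by rewrite /shift ifF //=; lia.
  - by by_points.
split=> -[a oa al]; have at_ : a < t by case/andP: oa.
  by exists a; rewrite -?(E a).
by exists a; rewrite ?(E a).
Qed.

Lemma open_right_at l :
  open_label ins true m.+1 l <-> open_label st true m l \/ l = m.+1.
Proof.
have om : is_open ins true m.+1 m.
  rewrite /is_open ltnSn /= eqxx /new_left; case: (ltnP m k) => //=; lia.
have lm : label ins (true, m) = m.+1 by exact: label_new_right.
have E a : a < m -> (is_open ins true m.+1 a = is_open st true m a) *
    (label ins (true, a) = label st (true, a)).
  move=> am; apply: open_shift => [|||[[] c] /= ck]; last by by_points.
  - by lia.
  - by rewrite /shift ifF //=; lia.
  - by lia.
  - by by_points.
split=> [[a oa al]|[[a oa al]|->]]; last by exists m.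
  have [am|ma|am] := ltngtP a m.
  - by left; exists a; rewrite -?(E a).
  - by case/andP: oa; lia.
  - by right; rewrite -al am lm.
have am : a < m by case/andP: oa.
by exists a; rewrite ?(E a).
Qed.

(** Beyond the new arc, the two additional nodes that have been read are joined
    to each other, so they leave the set of open labels as it was. *)
Lemma open_right_above t l : m <= t -> t < k ->
  open_label ins true t.+2 l <-> open_label st true t l.
Proof.
move=> mt tk.
have E a x : a < t -> shift k m (true, a) = (true, x) ->
    (is_open ins true t.+2 x = is_open st true t a) *
    (label ins (true, x) = label st (true, a)).
  move=> at_ Ex; apply: open_shift => // [||[[] c] /= ck]; last by by_points.
  - by lia.
  - by rewrite at_; move: Ex; by_points => -[]; lia.
  - by by_points.
split=> [[x ox xl]|[a oa al]].
  have xt : x < t.+2 by case/andP: ox.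
  have [y Ey] : exists y, y = (true, x) by exists (true, x).
  move: ox; rewrite /is_open; case: (pointP mk y) Ey => [||{}y yk] Ey.
  - rewrite -Ey mate_new_right /new_left; case: (ltnP m k) => /=; lia.
  - rewrite -Ey mate_new_left /new_right /=; case: (ltnP m k) => /=; lia.
  - move=> ox; case: y yk Ey => [[] a] /= ak Ea; last by [].
    have at_ : a < t by move: Ea; by_points => -[]; lia.
    by exists a; rewrite -?(E a x) // /is_open xt.
have at_ : a < t by case/andP: oa.
exists (if a < m then a else a.+2); rewrite ?(E a) //;
  by move: at_ mt tk; clear; by_points => //; exfalso; lia.
Qed.

End OpenInsert.

(** In a diagram of rank k, the arcs that are open when all k nodes of one side
    have been read are those that join the two sides. *)
Lemma open_left_right k st l : okada_matching k st ->
  open_label st false k l <-> open_label st true k l.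
Proof.
move=> ok.
have sw b : open_label st b k l -> open_label st (~~ b) k l.
  case=> a /andP[ak oa] al; have mk := mate_lt ok (leqnn k) (ak : (b, a).2 < k).
  rewrite mk andbT in oa; case Em: (mate st (b, a)) oa mk => [c d] /= cb dk.
  have Ec : (~~ b, d) = mate st (b, a).
    by rewrite Em; congr pair; case: b c cb {al Em} => [] [].
  exists d; last by rewrite Ec (label_mate ok).
  by rewrite /is_open Ec (mateK ok) dk /=; case: b {al Em cb Ec}.
by split=> /sw.
Qed.

(** * Growth diagrams record open labels *)

Section Growth.

Variables (N : nat) (s : 'S_N).

(** The number of boxes to the left of and below the vertex (i, j), which is
    the rank of the Fibonacci set at this vertex. *)
Definition boxes i j : nat := #|[set a : 'I_N | (a < i) && (s a < j)]%SET|.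

Lemma boxes_0l j : boxes 0 j = 0.
Proof. by apply/eqP; rewrite cards_eq0; apply/eqP/setP=> a; rewrite !inE. Qed.

Lemma boxes_0r i : boxes i 0 = 0.
Proof. by apply/eqP; rewrite cards_eq0; apply/eqP/setP=> a; rewrite !inE andbF. Qed.

Lemma boxesS_l (a : 'I_N) j : boxes a.+1 j = (boxes a j + (s a < j))%N.
Proof.
rewrite /boxes (cardsD1 a) inE ltnSn addnC; congr (_ + _)%N.
apply: eq_card => b; rewrite !inE -(inj_eq val_inj) ltnS [in RHS]ltn_neqAle.
by rewrite andbA.
Qed.

Lemma boxesS_r i (b : 'I_N) : boxes i b.+1 = (boxes i b + ((s^-1)%g b < i))%N.
Proof.
rewrite /boxes (cardsD1 ((s^-1)%g b)) inE permKV ltnSn andbT addnC; congr (_ + _)%N.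
apply: eq_card => a; rewrite !inE ltnS (ltn_neqAle (s a)).
have -> : (a == (s^-1)%g b) = (s a == b :> nat).
  by rewrite -[LHS](inj_eq (@perm_inj _ s)) permKV.
by rewrite andbCA.
Qed.

Lemma boxes_full_r i : i <= N -> boxes i N = i.
Proof.
elim: i => [|i IHi] iN; first exact: boxes_0l.
by rewrite (boxesS_l (Ordinal iN)) IHi ?(ltnW iN) // ltn_ord addn1.
Qed.

Lemma boxes_full_l j : j <= N -> boxes N j = j.
Proof.
elim: j => [|j IHj] jN; first exact: boxes_0r.
by rewrite (boxesS_r _ (Ordinal jN)) IHj ?(ltnW jN) // ltn_ord addn1.
Qed.

Lemma boxes_code (b : 'I_N) : (boxes ((s^-1)%g b) b + code s b)%N = b.
Proof.
set p := (s^-1)%g b; rewrite -[RHS](boxes_full_l (ltnW (ltn_ord b))).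
have -> : code s b = #|[set a : 'I_N | (p < a) && (s a < b)]%SET|.
  rewrite -(card_imset _ (@perm_inj _ s)); apply: eq_card => c.
  apply/idP/imsetP=> [|[a + ->]]; rewrite !inE.
    by move=> H; exists ((s^-1)%g c); rewrite ?inE permKV // andbC.
  by rewrite permK andbC.
rewrite /boxes -(cardsID [set a : 'I_N | a < p]%SET
  [set a : 'I_N | (a < N) && (s a < b)]%SET).
congr (_ + _)%N; apply: eq_card => a; rewrite !inE ltn_ord /= 1?andbC //.
rewrite andbC -leqNgt [p <= a]leq_eqVlt; have [<-|pa] := eqVneq p a.
  by rewrite permKV !ltnn /= andbF.
by rewrite (inj_eq (@ord_inj N)) (negPf pa).
Qed.

(** The place of the box of row k among the boxes of the rows below it, counted
    from 0; this is where the insertion of the value k+1 takes place. *)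
Definition box_pos k : nat :=
  if insub k is Some b then boxes ((s^-1)%g b) b else 0.

Lemma box_posE (b : 'I_N) : box_pos b = boxes ((s^-1)%g b) b.
Proof. by rewrite /box_pos valK. Qed.

Lemma box_pos_leq k : k < N -> box_pos k <= k.
Proof.
move=> kN; rewrite (box_posE (Ordinal kN)).
by have /= := boxes_code (Ordinal kN); lia.
Qed.

Lemma okada_permE : okada_perm s = diag_of N (insertions box_pos N).
Proof.
pose c k := if insub k is Some b then code s b else 0.
rewrite -(insertionsE (c := c)).
  by rewrite big_mkord; apply: eq_bigr => b _; rewrite /c valK.
move=> k kN; rewrite (box_posE (Ordinal kN)).
have -> : c k = code s (Ordinal kN) by rewrite /c -[k]/(val (Ordinal kN)) valK.
by have /= := boxes_code (Ordinal kN); lia.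
Qed.

Let st k := insertions box_pos k.

Lemma okada_st k : k <= N -> okada_matching k (st k).
Proof.
by move=> kN; apply: okada_insertions => j jk; apply/box_pos_leq/(leq_trans jk).
Qed.

Lemma boxes_leq i j : i <= N -> j <= N -> boxes i j <= j.
Proof.
move=> iN jN; rewrite -[X in _ <= X](boxes_full_l jN).
by apply/subset_leq_card/subsetP=> a; rewrite !inE ltn_ord => /andP[].
Qed.

Lemma boxes_homo i i' j : i <= i' -> boxes i j <= boxes i' j.
Proof.
move=> ii; apply/subset_leq_card/subsetP=> a; rewrite !inE => /andP[ai ->].
by rewrite (leq_trans ai).
Qed.

(** A vertex (i, k) is reached after [boxes i k] nodes: columns whose box
    lies above the height k contribute no step to the chain at this height. *)
Lemma growth_labels k i : k <= N -> i <= N ->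
  rank (growth s i k) = boxes i k /\
  forall l, l \in elts (growth s i k) <-> open_label (st k) true (boxes i k) l.
Proof.
elim: k i => [|k IHk] i kN iN.
  by rewrite growth_0 boxes_0r; split=> // l; split=> // -[a /andP[]].
have kN' := ltnW kN; pose b := Ordinal kN; pose p := (s^-1)%g b.
have posE : box_pos k = boxes p k by exact: (box_posE b).
have okk := okada_st kN'; have pk : box_pos k <= k := box_pos_leq kN.
elim: i iN => [|i IHi] iN.
  by rewrite boxes_0l; split=> // l; split=> // -[a /andP[]].
have iN' := ltnW iN; pose a := Ordinal iN.
have [rS eS] := IHk i kN' iN'; have [rS2 eS2] := IHk i.+1 kN' iN.
have {IHi} [rS1 eS1] := IHi iN'.
have V : edge (p < i) (growth s i k) (growth s i k.+1).
  by have [V _] := growth_edges s iN'; apply: (V b).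
have H : edge (s a < k) (growth s i k) (growth s i.+1 k).
  by have [_ H] := growth_edges s iN'; apply: (H a).
rewrite growthSS /local_rule (has_boxE s a b).
have bS1 : boxes i k.+1 = (boxes i k + (p < i))%N by exact: (boxesS_r i b).
have bS2 : boxes i.+1 k = (boxes i k + (s a < k))%N by exact: (boxesS_l a k).
have bT : boxes i.+1 k.+1 = (boxes i.+1 k + (p < i.+1))%N by exact: (boxesS_r i.+1 b).
have sab : (s a == b) = (a == p) by rewrite -[RHS](inj_eq (@perm_inj _ s)) permKV.
have stS : st k.+1 = insert_arc k (box_pos k) (st k) by [].
move: (growth s i k) (growth s i k.+1) (growth s i.+1 k) rS eS rS1 eS1 rS2 eS2 V H.
move=> S S1 S2 rS eS rS1 eS1 rS2 eS2 V H.
have [ip|pi|Eip] := ltngtP i p.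
(* Left of the box of row k: the new row repeats the old one. *)
- rewrite (ltnNge p) (ltnW ip) /= in V; rewrite V eqxx /= in eS1 *.
  have -> : (s a == b) = false.
    by rewrite sab; apply/eqP=> Ea; move: ip; rewrite -Ea ltnn.
  rewrite andbF bT ltnS leqNgt ip addn0; split=> // l.
  rewrite eS2 stS; apply: iff_sym; apply: (open_right_below pk okk).
  by rewrite posE; apply: boxes_homo.
(* Right of the box: a step of the old row is repeated in rank two higher. *)
- rewrite pi in V; rewrite (fib_cover_neq V) /=.
  rewrite bT ltnS (ltnW pi) bS2.
  have [sk|sk] := boolP (s a < k).
    rewrite sk in H; rewrite (fib_cover_neq H) /= addn1; split.
      by rewrite /rank /= -/(rank _) rS addn1.
    move=> l; rewrite addn1 stS /elts /= -/(elts _) eS; apply: iff_sym.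
    apply: (open_right_above pk okk); first by rewrite posE; apply/boxes_homo/ltnW.
    by have := boxes_leq iN kN'; rewrite bS2 sk addn1.
  rewrite (negPf sk) in H; rewrite H eqxx /= addn0.
  by rewrite bS1 pi in eS1 rS1.
(* The column of the box: the new arc opens. *)
- have Ea : a = p by apply: val_inj.
  have sk : (s a < k) = false by rewrite Ea permKV /= ltnn.
  rewrite Eip ltnn /= in V; rewrite sk /= in H.
  rewrite V H sab Ea !eqxx /= bT bS2 sk addn0 Eip ltnSn addn1 -Eip; split.
    by rewrite /rank /= -/(rank _) rS.
  move=> l; rewrite /elts /= -/(elts _) mem_rcons inE orbC.
  have bE : box_pos k = boxes i k by rewrite posE Eip.
  rewrite stS -[X in open_label _ _ X.+1]bE.
  split=> [/orP[/eS|/eqP->] | /(open_right_at pk okk)[|->]].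
  - by move=> H1; apply/(open_right_at pk okk); left; rewrite bE.
  - by apply/(open_right_at pk okk); right; rewrite bE rS.
  - by rewrite bE => /eS->.
  - by rewrite bE rS eqxx orbT.
Qed.

Lemma growth_right i : i <= N -> forall l,
  l \in elts (growth s i N) <-> open_label (st N) true i l.
Proof.
by move=> iN l; have [_ ->] := growth_labels (leqnn N) iN; rewrite boxes_full_r.
Qed.

(** At the right end of row j the open labels are those of the arcs joining the
    two sides of the diagram of rank j; they are open on the left side after its
    j nodes, and remain so in all later diagrams. *)
Lemma growth_left j : j <= N -> forall l,
  l \in elts (growth s N j) <-> open_label (st N) false j l.
Proof.
move=> jN l; have [_ ->] := growth_labels jN (leqnn N); rewrite boxes_full_l //.
rewrite -(open_left_right l (okada_st jN)).
have [n EN] : exists n, N = (j + n)%N by exists (N - j); lia.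
suff H i : (j + i <= N)%N ->
    open_label (st (j + i)%N) false j l <-> open_label (st j) false j l.
  by rewrite [in st N]EN H ?EN.
elim: i => [|i IHi] jiN; first by rewrite addn0.
rewrite addnS in jiN *; rewrite -IHi; last exact: ltnW.
apply: open_left_insert; [exact: box_pos_leq|exact/okada_st/ltnW|exact: leq_addr].
Qed.

End Growth.

Lemma local_ruleC b S S1 S2 : local_rule b S S1 S2 = local_rule b S S2 S1.
Proof.
by rewrite /local_rule; case: (S1 =P S) => [->|_]; case: (S2 =P S) => // ->; case: b.
Qed.

(** Inverting s reflects the boxes in the diagonal, and the local rule is
    symmetric. *)
Lemma growthV N (s : 'S_N) i j : growth (s^-1)%g i j = growth s j i.
Proof.
elim: i j => [|i IHi] j; first by rewrite growth_0.
elim: j => [|j IHj]; first by rewrite growth_0.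
rewrite !growthSS IHj !IHi local_ruleC; congr local_rule.
apply/existsP/existsP => -[k /andP[/eqP Ek /eqP El]].
  by exists ((s^-1)%g k); rewrite permKV Ek El !eqxx.
by exists (s k); rewrite permK Ek El !eqxx.
Qed.

(** * Half diagrams and chains of open labels *)
Lemma before_total x y : before x y \/ before y x \/ x = y.
Proof.
move: x y => [[] a] [[] b]; rewrite /before /=; try by [left|right; left];
  have [ab|ba|->] := ltngtP a b; by [left|right; left|right; right].
Qed.

Section Half.

Variables (N : nat) (st : matching) (ok : okada_matching N st).

Definition half_block i (x : 'I_N) : {set 'I_N} :=
  [set y : 'I_N | (y < i) &&
     ((y == x) || (mate st (false, val y) == (false, val x)))]%SET.

(** The half diagram of the left side after i nodes; arcs that end at a later
    node are still half arcs. *)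
Definition half_upto i : half_diagram N :=
  [fset (half_block i x, label st (false, val x)) | x in [set x : 'I_N | x < i]%SET].

(** Both arcs end after all the nodes read so far, so they are nested. *)
Lemma open_label_inj t a b : is_open st false t a -> is_open st false t b ->
  label st (false, a) = label st (false, b) -> a = b.
Proof.
wlog ab : a b / a < b => [H oa ob lab_|].
  have [ab|ba|//] := ltngtP a b; first exact: H.
  by apply/esym/H.
case/andP=> at_ oa /andP[bt ob] lab_; exfalso.
have nc := matching_noncrossing ok (x := (false, a)) (y := (false, b)).
have ns := matching_nested ok (x := (false, a)) (y := (false, b)).
rewrite lab_ ltnn in ns.
have bm c : is_open st false t c -> before (false, b) (mate st (false, c)).
  by case/andP=> _; case: (mate _ _) => [[] e]; rewrite /before //=; lia.
have bX := bm a (introT andP (conj at_ oa)); have bY := bm b (introT andP (conj bt ob)).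
have [XY|[YX|XY]] := before_total (mate st (false, a)) (mate st (false, b)).
- exact: (nc (And3 ab bX XY)).
- by suff : false by []; exact: (ns (And3 ab bY YX)).
- by move: ab; have [->] := can_inj (mateK ok) XY; rewrite ltnn.
Qed.

Lemma half_blockS i (iN : i < N) (x : 'I_N) : x < i ->
  half_block i.+1 x = if mate st (false, i) == (false, val x)
    then (Ordinal iN |: half_block i x)%SET else half_block i x.
Proof.
move=> xi; apply/setP=> y; have [->|yi] := eqVneq y (Ordinal iN).
  rewrite !inE /= ltnSn /= -(inj_eq val_inj) /= gtn_eqF //=.
  by case: eqP; rewrite !inE /= ?eqxx ?ltnn.
have E : (y < i.+1) = (y < i).
  by rewrite ltnS leq_eqVlt -(inj_eq val_inj) /= in yi *; rewrite (negPf yi).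
by case: ifP; rewrite !inE E ?(negPf yi).
Qed.

Lemma half_block_id i (x : 'I_N) : x < i -> x \in half_block i x.
Proof. by move=> xi; rewrite inE xi eqxx. Qed.

Lemma card_half_block i (x : 'I_N) : x < i ->
  (#|half_block i x| == 1) = is_open st false i x.
Proof.
move=> xi; rewrite /is_open xi /=; apply/cards1P/idP => [[z Ez]|xo].
  have := half_block_id xi; rewrite Ez inE => /eqP xz.
  apply/negP=> /andP[/eqP s1 s2]; have mi : (mate st (false, val x)).2 < N.
    by apply: (mate_lt ok (leqnn N)); apply: ltn_ord x.
  have : Ordinal mi \in half_block i x.
    rewrite inE s2 /=; apply/orP; right; apply/eqP.
    rewrite -[RHS](mateK ok); congr mate.
    by case: (mate st _) s1 => u v /= ->.
  rewrite Ez inE -xz -(inj_eq val_inj) /= => /eqP E.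
  case/eqP: (mate_neq ok (false, x : nat)).
  by case: (mate st _) s1 E => u v /= -> ->.
exists x; apply/setP=> y; rewrite !inE.
have [->|yx] /= := eqVneq y x; first by rewrite xi.
apply: contraNF xo => /andP[yi /eqP E].
by rewrite -E (mateK ok) /= yi.
Qed.

Lemma left_half_diag_of : left_half (diag_of N st) = half_upto N.
Proof.
have supp_arc (x : 'I_N) :
    [set i : 'I_N | inl i \in arc_of st (inl x)]%SET = half_block N x.
  apply/setP=> y; rewrite !inE ltn_ord /=; congr orb.
  by rewrite -(inj_eq (can_inj (mateK ok))) (mateK ok).
apply/fsetP=> q; apply/imfsetP/imfsetP=> -[/= p].
  rewrite !inE => /andP[pD /existsP[x xp]] ->; exists x; rewrite ?inE ?ltn_ord //.
  by rewrite (diag_ofP ok pD xp) supp_arc.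
rewrite inE => _ ->; exists (arc_of st (inl p), label st (false, val p)).
  rewrite !inE (mem_diag_of st (inl p)) /=.
  by apply/existsP; exists p; apply: arc_of_id.
by rewrite supp_arc.
Qed.

Lemma mem_prop_lab l : l \in prop_lab (half_upto N) <-> open_label st false N l.
Proof.
split=> [/imfsetP[/= p] | [a oa <-]].
  rewrite !inE => /andP[/imfsetP[/= x xN ->] /= cx] ->.
  by exists x; rewrite // -card_half_block.
have aN : a < N by case/andP: oa.
apply/imfsetP; exists (half_block N (Ordinal aN), label st (false, a)) => //=.
rewrite !inE /= card_half_block // oa andbT.
by apply/imfsetP; exists (Ordinal aN); rewrite ?inE.
Qed.

(** A label enters the set of open labels when an arc opens and leaves it when
    that arc closes; by [open_label_inj] it tells which arc this is. *)
Lemma Diag_of_open_labels (C : chain N) :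
    (forall i, i <= N -> forall l,
       l \in elts (nth fib0 (val C) i) <-> open_label st false i l) ->
  Diag C = left_half (diag_of N st).
Proof.
move=> CP; rewrite left_half_diag_of /Diag.
suff H i : i <= N ->
    foldl (Diag_step (val C)) fset0 (take i (enum 'I_N)) = half_upto i.
  by have := H N (leqnn N); rewrite take_oversize // size_enum_ord.
elim: i => [|i IHi] iN.
  rewrite take0 /=; apply/fsetP=> p; rewrite inE; apply/esym/negP=> /imfsetP[x].
  by rewrite inE.
rewrite (take_nth (Ordinal iN)) ?size_enum_ord // foldl_rcons {}IHi ?(ltnW iN) //.
have -> : nth (Ordinal iN) (enum 'I_N) i = Ordinal iN.
  by apply: val_inj; rewrite /= nth_enum_ord.
rewrite /Diag_step /=.
have SP := CP i (ltnW iN); have TP := CP i.+1 iN.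
move: (elts (nth _ _ i)) (elts (nth _ _ i.+1)) SP TP => S T SP TP.
set o := Ordinal iN.
have [mi|mi] := boolP (is_open st false i.+1 i).
  (* The arc at i opens. *)
  have oS a : is_open st false i a -> is_open st false i.+1 a.
    case/andP=> ai oa; rewrite /is_open ltnS (ltnW ai) /=.
    apply: contra oa => /andP[/eqP m1]; rewrite ltnS leq_eqVlt => /orP[/eqP m2|m2].
      have Em : mate st (false, i) = (false, a).
        by rewrite -(mateK ok (false, a)) [mate st (false, a)]surjective_pairing m1 m2.
      by move: mi; rewrite /is_open Em /= ltnSn ltnS (ltnW ai).
    by rewrite m1 eqxx.
  have li a : is_open st false i a -> label st (false, a) <> label st (false, i).
    by move=> oa /(open_label_inj (oS a oa) mi) E; move: oa; rewrite E /is_open ltnn.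
  rewrite ifT; last first.
    by apply/allP=> l /SP[a oa <-]; apply/TP; exists a => //; apply: oS.
  have blockS (x : 'I_N) : x < i -> half_block i.+1 x = half_block i x.
    move=> xi; rewrite (half_blockS iN xi) ifF //; apply/negP=> /eqP E.
    by move: mi; rewrite /is_open E /= ltnSn ltnS (ltnW xi).
  have block_o : half_block i.+1 o = [set o]%SET.
    have oi : o < i.+1 by [].
    have /cards1P[z Ez] : #|half_block i.+1 o| == 1 by rewrite card_half_block.
    by have := half_block_id oi; rewrite Ez inE => /eqP->.
  apply/fsetP=> p; rewrite inE.
  apply/orP/imfsetP=> [[/imfsetP[/= x]|/imfsetP[/= l]]|[/= x]].
  - rewrite inE => xi ->; exists x; rewrite ?inE ?(ltnW xi) ?blockS //.
    by rewrite ltnS ltnW.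
  - rewrite mem_filter => /andP[lS /TP[a oa al]] ->.
    exists o; first by rewrite inE /= ltnSn.
    rewrite block_o -al; have [->//|ai] := eqVneq a i.
    case/negP: lS; apply/SP; exists a => //; move: oa.
    by rewrite /is_open ltnS leq_eqVlt (negPf ai) /= => /andP[-> ];
      apply: contra => /andP[-> /leqW].
  - rewrite inE ltnS leq_eqVlt => /orP[/eqP xi|xi] ->.
      have -> : x = o by apply: val_inj.
      right; apply/imfsetP; exists (label st (false, i)); rewrite ?block_o //=.
      rewrite mem_filter; apply/andP; split; last by apply/TP; exists i.
      by apply/negP=> /SP[a /li].
    by left; apply/imfsetP; exists x; rewrite ?inE ?blockS.
(* The arc at i closes an arc that was opened at j. *)
have [j ji mj] : exists2 j, j < i & mate st (false, i) = (false, j).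
  move: mi; rewrite /is_open ltnSn /= negbK; have := mate_neq ok (false, i).
  case: (mate _ _) => u j nij /= /andP[/eqP uE]; rewrite {}uE in nij *.
  rewrite ltnS leq_eqVlt => /orP[/eqP ji|]; last by exists j.
  by rewrite ji eqxx in nij.
have mj' : mate st (false, j) = (false, i) by rewrite -mj (mateK ok).
have jN : j < N := ltn_trans ji iN.
have lj : label st (false, i) = label st (false, j) by rewrite -(label_mate ok) mj.
have oj : is_open st false i j by rewrite /is_open ji mj' /= ltnn.
have oS a : is_open st false i.+1 a = is_open st false i a && (a != j).
  rewrite /is_open ltnS leq_eqVlt; have [->|ai] := eqVneq a i.
    by rewrite mj /= ltnn ltnS (ltnW ji).
  case: ltnP => //= ai'; have [->|aj] := eqVneq a j; first by rewrite mj' /= ltnSn andbF.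
  rewrite andbT ltnS leq_eqVlt; congr (~~ _).
  case: eqP => //= m1; case: eqP => //= m2; case/eqP: aj.
  have : mate st (false, a) = (false, i) by rewrite [LHS]surjective_pairing m1 m2.
  by rewrite -mj' => /(can_inj (mateK ok)) [].
have TS l : l \in T <-> l \in S /\ l <> label st (false, j).
  split=> [/TP[a]|[/SP[a oa <-] nl]].
    rewrite oS => /andP[oa aj] <-; split; first by apply/SP; exists a.
    by move/(open_label_inj oa oj)/eqP; rewrite (negPf aj).
  by apply/TP; exists a => //; rewrite oS oa; apply/eqP=> E; case: nl; rewrite E.
have jS : label st (false, j) \in S by apply/SP; exists j.
have jT : label st (false, j) \notin T by apply/negP=> /TS[].
rewrite ifF; last by apply/negP=> /allP/(_ _ jS); apply/negP.
have blockS (x : 'I_N) : x < i -> x != j :> nat -> half_block i.+1 x = half_block i x.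
  by move=> xi xj; rewrite (half_blockS iN xi) mj xpair_eqE eq_sym (negPf xj).
have blockj : half_block i.+1 (Ordinal jN) = (o |: half_block i (Ordinal jN))%SET.
  by rewrite (half_blockS iN) //= mj eqxx.
have step (x : 'I_N) : x < i ->
    (if [&& #|half_block i x| == 1, label st (false, val x) \in S
         & label st (false, val x) \notin T]
     then (o |: half_block i x)%SET else half_block i x) = half_block i.+1 x.
  move=> xi; rewrite card_half_block //; have [xj|xj] := eqVneq (x : nat) j.
    have -> : x = Ordinal jN by apply: val_inj.
    by rewrite /= oj jS jT blockj.
  rewrite blockS //; case: ifP => // /and3P[ox lS] /negP[]; apply/TS; split=> //.
  by move/(open_label_inj ox oj)/eqP; rewrite (negPf xj).
have block_o : half_block i.+1 o = half_block i.+1 (Ordinal jN).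
  rewrite blockj; apply/setP=> y; rewrite !inE /=; have [->|yo] := eqVneq y o.
    by rewrite /= ltnSn.
  have nyi : (val y == i) = false by apply: contraNF yo => /eqP yi; apply/eqP/val_inj.
  have -> : (mate st (false, val y) == (false, i)) = (y == Ordinal jN).
    by rewrite -(inj_eq (can_inj (mateK ok))) (mateK ok) mj xpair_eqE -(inj_eq val_inj).
  have -> : (mate st (false, val y) == (false, j)) = false.
    by rewrite -(inj_eq (can_inj (mateK ok))) (mateK ok) mj' xpair_eqE nyi.
  by rewrite orbF ltnS leq_eqVlt nyi.
apply/fsetP=> p; apply/imfsetP/imfsetP => [[/= q /imfsetP[/= x + ->] ->] | [/= x + ->]].
  rewrite inE => xi; exists x; rewrite ?inE /= ?step //.
  exact: ltnW.
rewrite inE ltnS leq_eqVlt => /orP[/eqP xi|xi].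
  have -> : x = o by apply: val_inj.
  exists (half_block i (Ordinal jN), label st (false, j)).
    by apply/imfsetP; exists (Ordinal jN); rewrite ?inE.
  by have /= -> := step (Ordinal jN) ji; rewrite block_o /= lj.
exists (half_block i x, label st (false, val x)); last by rewrite /= step.
by apply/imfsetP; exists x; rewrite ?inE.
Qed.

End Half.

(** * Mirror images, and diagrams determined by their halves *)

Section Mirror.

Variable N : nat.
Implicit Types D E : diagram N.

Lemma nbarK : involutive (@nbar N).
Proof. by case. Qed.

Lemma mirrorK : involutive (@mirror N).
Proof.
have supp2 (p : labelled (node N)) :
    (@nbar N @: (@nbar N @: supp p), lab p) = p.
  case: p => A l; congr pair; rewrite -imset_comp -[RHS]imset_id.
  by apply: eq_imset => x; apply: nbarK.
move=> D; apply/fsetP=> p; apply/imfsetP/idP => [[/= q /imfsetP[/= r rD ->] ->]|pD].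
  by rewrite supp2.
exists (@nbar N @: supp p, lab p); last by rewrite supp2.
by apply/imfsetP; exists p.
Qed.

Definition mirror_matching st : matching :=
  {| mate x := flip (mate st (flip x)); label x := label st (flip x) |}.

Lemma flipK : involutive flip.
Proof. by case=> s a; rewrite /flip /= negbK. Qed.

Lemma before_flip x y : before (flip x) (flip y) = before y x.
Proof. by move: x y => [[] a] [[] b]; rewrite /before /=. Qed.

(** The mirror reverses the line, so the conditions for the points x and y are
    those of the original matching for the mates of their mirror images. *)
Lemma okada_mirror_matching k st :
  okada_matching k st -> okada_matching k (mirror_matching st).
Proof.
move=> ok; split=> /=.
- by move=> x; rewrite flipK (mateK ok) flipK.
- by move=> x; rewrite -(inj_eq (can_inj flipK)) flipK (mate_neq ok).
- by move=> x; rewrite flipK (label_mate ok).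
- by move=> x kx; rewrite (mate_strand ok) // flipK.
- by move=> x kx; rewrite (label_strand ok).
- by move=> x; apply: (label_gt0 ok).
- by move=> x; apply: (label_leq ok).
- by move=> x; apply: (label_odd ok).
- move=> x; have := mate_parity ok (flip x).
  by case: x => [[] a]; case: (mate st _) => [[] b] /=; lia.
- move=> x y _ _; rewrite -{1 2}[y]flipK -{1}[x]flipK !before_flip.
  move=> [yx mxy myx]; apply: (matching_noncrossing ok (x := mate st (flip y))
    (y := mate st (flip x))).
  by rewrite !(mateK ok) before_flip.
- move=> x y _ _; rewrite -{1 2}[y]flipK -{1}[x]flipK !before_flip.
  move=> [yx my mxy]; rewrite -(label_mate ok (flip x)) -(label_mate ok (flip y)).
  by apply: (matching_nested ok); rewrite !(mateK ok) before_flip.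
Qed.

Lemma mirror_diag_of st : mirror (diag_of N st) = diag_of N (mirror_matching st).
Proof.
have arcE x : @nbar N @: arc_of st x = arc_of (mirror_matching st) (nbar x).
  apply/setP=> y; rewrite -[y]nbarK (mem_imset _ _ (can_inj nbarK)) !inE.
  rewrite !nbar_point (inj_eq (can_inj flipK)) /=.
  rewrite [flip (flip (point_of x))]flipK.
  by rewrite -[X in _ = _ || X](inj_eq (can_inj flipK)) !flipK.
apply/fsetP=> p; apply/imfsetP/imfsetP => [[/= q /imfsetP[/= x _ ->] ->]|[/= x _ ->]].
  by exists (nbar x); rewrite ?inE // arcE /= nbar_point flipK.
exists (arc_of st (nbar x), label st (point_of (nbar x))).
  exact: mem_diag_of.
by rewrite /= arcE nbarK nbar_point.
Qed.

Lemma open_label_mirror st t l :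
  open_label (mirror_matching st) false t l <-> open_label st true t l.
Proof.
have E a : is_open (mirror_matching st) false t a = is_open st true t a.
  by rewrite /is_open /flip /=; case: (mate st _) => [[] b].
by split=> -[a oa al]; exists a; rewrite // -?E // ?E in oa *.
Qed.

Lemma perfect_block D p q x : perfect_matching D -> p \in D -> q \in D ->
  x \in supp p -> x \in supp q -> p = q.
Proof.
move=> [_ /(_ x) [r [_ rP]]] pD qD xp xq.
by rewrite -(rP p) // -(rP q).
Qed.

Lemma mirror_arc D x y l : ([set x; y]%SET, l) \in D ->
  ([set nbar x; nbar y]%SET, l) \in mirror D.
Proof.
move=> pD; apply/imfsetP; exists ([set x; y]%SET, l) => //=.
by rewrite /supp /= imsetU1 imset_set1.
Qed.

Definition pairs D : Prop := forall p, p \in D -> #|supp p| = 2.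

Lemma pairs_mirror D : pairs D -> pairs (mirror D).
Proof.
move=> cD _ /imfsetP[/= p pD ->]; rewrite /supp /= card_imset; first exact: cD.
exact: can_inj nbarK.
Qed.

Lemma left_half_arc D E i j l : pairs E -> left_half D = left_half E ->
  ([set inl i; inl j]%SET, l) \in D -> i != j -> ([set inl i; inl j]%SET, l) \in E.
Proof.
move=> cE DE pD ij.
have : ([set k | k \in [set i; j]%SET]%SET, l) \in left_half D.
  apply/imfsetP; exists ([set inl i; inl j]%SET, l) => /=.
    by rewrite !inE pD; apply/existsP; exists i; rewrite /supp /= !inE eqxx.
  by congr pair; apply/setP=> k; rewrite /supp /= !inE.
rewrite DE => /imfsetP[/= q]; rewrite !inE => /andP[qE _] [Eq ->].
suff -> : [set inl i; inl j]%SET = supp q by case: (q) qE.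
apply/eqP; rewrite eqEcard cE // cards2 (inj_eq (@inl_inj _ _)) ij andbT.
apply/subsetP=> x; rewrite !inE => /orP[]/eqP->.
  by have /setP/(_ i) := Eq; rewrite !inE eqxx => <-.
by have /setP/(_ j) := Eq; rewrite !inE eqxx orbT => <-.
Qed.

Lemma left_half_prop D E i j l : pairs E -> left_half D = left_half E ->
  ([set inl i; inr j]%SET, l) \in D ->
  exists j', ([set inl i; inr j']%SET, l) \in E.
Proof.
move=> cE DE pD.
have : ([set i]%SET, l) \in left_half D.
  apply/imfsetP; exists ([set inl i; inr j]%SET, l) => /=.
    by rewrite !inE pD; apply/existsP; exists i; rewrite /supp /= !inE eqxx.
  by congr pair; apply/setP=> k; rewrite /supp /= !inE orbF (inj_eq (@inl_inj _ _)).
rewrite DE => /imfsetP[/= q]; rewrite !inE => /andP[qE _] [Eq ->].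
have iq : inl i \in supp q by have /setP/(_ i) := Eq; rewrite !inE eqxx => <-.
have /eqP/cards2P[x [y [xy Ex]]] := cE q qE.
have mq (z : node N) : (z \in supp q) = (z == x) || (z == y) by rewrite Ex !inE.
have [z [zi Ez]] : exists z, z != inl i /\ supp q = [set inl i; z]%SET.
  move: iq; rewrite mq => /orP[]/eqP ->; first by exists y; rewrite eq_sym.
  by exists x; rewrite setUC.
case: z zi Ez => [k|j'] zi Ez; last by exists j'; rewrite -Ez; case: (q) qE.
have /setP/(_ k) := Eq; rewrite !inE Ez !inE eqxx orbT => /eqP ki.
by rewrite ki eqxx in zi.
Qed.

(** Arcs within a side are visible in a half.  The ends of a propagating arc of
    D carry the same label in the halves of E, where they belong to a single
    arc: E has no two propagating arcs with the same label. *)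
Lemma eq_halves_sub D E p : okada D -> okada E ->
  left_half D = left_half E -> right_half D = right_half E -> p \in D -> p \in E.
Proof.
move=> okD okE lDE rDE pD; have [[cD _] _ _ _] := okD.
have [pmE ncE _ niE] := okE; have [cE _] := pmE.
have right_arc (i j : 'I_N) l : ([set inr i; inr j]%SET, l) \in D -> i != j ->
    ([set inr i; inr j]%SET, l) \in E.
  move=> /mirror_arc ijD ij; rewrite -[E]mirrorK.
  by apply: (mirror_arc (x := inl i) (y := inl j)); apply: left_half_arc ijD ij;
    [apply: pairs_mirror|].
have prop_lt (i i' j j' : 'I_N) l : ([set inl i; inr j]%SET, l) \in E ->
    ([set inl i'; inr j']%SET, l) \in E -> i < i' -> False.
  move=> pE qE ii; have iN := ltn_ord i'; have jN := ltn_ord j; have jN' := ltn_ord j'.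
  have [jj|jj|/val_inj jj] := ltngtP j j'.
  - have := niE _ _ _ _ _ _ qE pE; rewrite ltnn => H.
    by suff : false by []; apply: H; split=> /=; lia.
  - by apply: (ncE _ _ _ _ _ _ pE qE); split=> /=; lia.
  - have jp : inr j \in supp ([set inl i; inr j]%SET, l) by rewrite /supp !inE eqxx orbT.
    have jq : inr j \in supp ([set inl i'; inr j']%SET, l).
      by rewrite /supp !inE jj eqxx orbT.
    have [/setP/(_ (inl i))] := perfect_block pmE pE qE jp jq.
    by rewrite !inE eqxx /= => /esym/orP[/eqP[Ei]|/eqP //]; rewrite Ei ltnn in ii.
have prop_arc (i j : 'I_N) l : ([set inl i; inr j]%SET, l) \in D ->
    ([set inl i; inr j]%SET, l) \in E.
  move=> ijD; have [j' ij'E] := left_half_prop cE lDE ijD.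
  have [i' i'jE] : exists i', ([set inl i'; inr j]%SET, l) \in E.
    have := mirror_arc ijD; rewrite /= setUC => /(left_half_prop (pairs_mirror cE) rDE).
    by case=> i' /mirror_arc; rewrite mirrorK /= setUC; exists i'.
  have [ii|ii|/val_inj ii] := ltngtP i i'.
  - by case: (prop_lt _ _ _ _ _ ij'E i'jE ii).
  - by case: (prop_lt _ _ _ _ _ i'jE ij'E ii).
  - by rewrite ii.
have /eqP/cards2P[x [y [xy Ep]]] := cD p pD.
have {}Ep : p = ([set x; y]%SET, lab p) by rewrite -Ep; case: (p).
rewrite Ep in pD *; move: (lab p) pD => l {Ep}.
case: x y xy => [i|i] [j|j] xy pD.
- exact: left_half_arc pD xy.
- exact: prop_arc.
- by rewrite setUC in pD *; apply: prop_arc.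
- exact: right_arc.
Qed.

Lemma is_bowtie_halves D : okada D -> okada (mirror D) ->
  prop_lab (left_half D) = prop_lab (right_half D) ->
  is_bowtie (left_half D) (right_half D) D.
Proof.
move=> okD okM eqP; split=> //; [by exists D|by exists (mirror D)|].
split=> // E [okE lE rE]; apply/fsetP=> p.
by apply/idP/idP; apply: eq_halves_sub.
Qed.

End Mirror.

(** * The permutation diagram *)

Section PermutationDiagram.

Variables (N : nat) (s : 'S_N).

Let st := insertions (box_pos s) N.
Let ok : okada_matching N st := okada_st s (leqnn N).

Lemma left_half_okada_perm : left_half (okada_perm s) = Diag (Pchain s).
Proof.
rewrite okada_permE (Diag_of_open_labels ok) // => i iN l.
by rewrite nth_mkseq ?ltnS // growth_left.
Qed.

Lemma right_half_okada_perm : right_half (okada_perm s) = Diag (Qchain s).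
Proof.
rewrite okada_permE /right_half mirror_diag_of.
rewrite (Diag_of_open_labels (okada_mirror_matching ok)) // => i iN l.
by rewrite nth_mkseq ?ltnS // open_label_mirror growth_right.
Qed.

Lemma okada_okada_perm : okada (okada_perm s) /\ okada (mirror (okada_perm s)).
Proof.
rewrite okada_permE mirror_diag_of; split; apply: okada_diag_of (leqnn N) _ => //.
exact: okada_mirror_matching.
Qed.

Lemma okada_perm_bowtie :
  is_bowtie (Diag (Pchain s)) (Diag (Qchain s)) (okada_perm s).
Proof.
have [okA okM] := okada_okada_perm.
rewrite -left_half_okada_perm -right_half_okada_perm.
apply: is_bowtie_halves => //; rewrite okada_permE /right_half mirror_diag_of.
have okm := okada_mirror_matching ok.
rewrite (left_half_diag_of ok) (left_half_diag_of okm); apply/fsetP=> l.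
apply/idP/idP; rewrite !mem_prop_lab // open_label_mirror open_left_right //.
Qed.

End PermutationDiagram.

Lemma Pchain_inv N (s : 'S_N) : Pchain (s^-1)%g = Qchain s.
Proof. by apply: val_inj; apply: eq_map => j; apply: growthV. Qed.

Lemma Qchain_inv N (s : 'S_N) : Qchain (s^-1)%g = Pchain s.
Proof. by rewrite -Pchain_inv invgK. Qed.

Theorem theorem4p14 (N : nat) (s : 'S_N) :
  let L := Diag (Pchain s) in
  let R := Diag (Qchain s) in
  is_bowtie L R (okada_perm s) /\
  mirror (okada_perm s) = okada_perm (s^-1)%g /\
  is_bowtie R L (okada_perm (s^-1)%g).
Proof.
move=> L R; have bowV := okada_perm_bowtie (s^-1)%g.
rewrite Pchain_inv Qchain_inv in bowV.
split; first exact: okada_perm_bowtie.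
split=> //; have [_ okM] := okada_okada_perm s.
case: bowV => _ _ _ [_ uniq]; apply/esym/uniq; split=> //.
  exact: right_half_okada_perm.
by rewrite /right_half mirrorK left_half_okada_perm.
Qed.
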